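(* Let $A$ be a quantum bi-quadratic algebra over a field $K$ with quantum parameter $q_1$. Then (up to $G_3'$) $$x_2x_1=qx_1x_2+cx_3+b_1,\quad x_3x_1=q^{-1}x_1x_3+\beta x_2+b_2,\quad x_3x_2=qx_2x_3+\lambda x_1+b_3,$$ where $q\in\{q_1,q_1^{-1}\}$ and (up to $G_3'$) the parameters $c,\beta,\lambda,b_1,b_2,b_3$ belong precisely to one of the four cases below: Case 1: $(c,\beta,\lambda)\in(1,K^\times/K^{\times 2},K^\times/K^{\times 2})$ and $b_1,b_2,b_3\in K$; Case 2: $\lambda=0$, $(c,\beta,b_3)\in(1,K^\times/K^{\times 4},1)\coprod(1,K^\times/K^{\times 2},0)$ and $b_1,b_2\in K$; Case 3: $\beta=\lambda=0$, $(c,b_2,b_3)\in(1,1,K^\times/K^{\times 3})\coprod\{(1,1,0),(1,0,0)\}$ and $b_1\in K$; Case 4: $c=\beta=\lambda=0$, $(b_1,b_2,b_3)\in(1,1,K^\times/K^{\times 2})\coprod\{(1,1,0),(1,0,0),(0,0,0)\}$. If, in addition, $\sqrt{K}\subseteq K$ and $\sqrt[3]{K}\subseteq K$ (every element of $K$ has a square root and a cube root in $K$) then (up to $G_3'$) there are the following 10 types of quantum bi-quadratic algebras: 1. $c=\beta=\lambda=1$ and $b_1,b_2,b_3\in K$. 2. $c=\beta=1$, $\lambda=0$ and $b_1,b_2\in K$, $b_3\in\{0,1\}$. 3. $c=1$, $\beta=\lambda=0$ and $b_1\in K$, $(b_2,b_3)\in\{(1,1),(1,0),(0,0)\}$. 4.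 $c=\beta=\lambda=0$ and $(b_1,b_2,b_3)\in\{(1,1,1),(1,1,0),(1,0,0),(0,0,0)\}$.
   Context: Let $K$ be a field, $K^\times=K\setminus\{0\}$. A bi-quadratic algebra on 3 generators is a $K$-algebra $A$ generated by $x_1,x_2,x_3$ subject to the defining relations $x_2x_1-q_1x_1x_2=ax_1+bx_2+cx_3+b_1$, $x_3x_1-q_2x_1x_3=\alpha x_1+\beta x_2+\gamma x_3+b_2$, $x_3x_2-q_3x_2x_3=\lambda x_1+\mu x_2+\nu x_3+b_3$, where $q_1,q_2,q_3\in K^\times$ and the other coefficients are in $K$, such that the monomials $x_1^ix_2^jx_3^k$ ($i,j,k\ge0$) form a $K$-basis of $A$ (PBW basis). It is called a quantum bi-quadratic algebra, with quantum parameter $q$, if $q:=q_1=q_2^{-1}=q_3\ne 1$. $G_3'$ is the group of changes of generators generated by the affine changes $x_i\mapsto\lambda_ix_i+\mu_i$ ($\lambda_i\in K^\times$, $\mu_i\in K$) and the permutations $x_i\mapsto x_{\sigma(i)}$, $\sigma\in S_3$. ''Up to $G_3'$'' means: after such a change of canonical generators the new canonical generators (again denoted $x_1,x_2,x_3$) have defining relations of the displayed form (with new parameters denoted by the same letters). For $n\ge 2$, here $K^{\times n}:=\{\xi^n\mid\xi\in K^\times\}$ (the group of $n$-th powers), and an expression like ''$\mu\in K^\times/K^{\times n}$'' means ''$\mu\in K^\times$ is unique up to $K^{\times n}$'', i.e. $\mu$ may be chosen as a representative of its class in $K^\times/K^{\times n}$; e.g. $(1,K^\times/K^{\times 2},0)$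 is the set of triples $(1,\mu,0)$ with $\mu\in K^\times$ taken modulo $K^{\times 2}$. *)

(* Defs.v *)
From HB Require Import structures.
From mathcomp Require Import all_boot all_order all_algebra all_fingroup.

Set Implicit Arguments.
Unset Strict Implicit.
Unset Printing Implicit Defensive.

Import GRing.Theory.
Local Open Scope ring_scope.

(* The generators x_1, x_2, x_3 are the values x 0, x 1, x 2 of a function
   x : 'I_3 -> A. *)

Record bq_params (K : fieldType) := BqParams {
  bq_q1 : K; bq_q2 : K; bq_q3 : K;
  bq_a : K; bq_b : K; bq_c : K; bq_b1 : K;
  bq_alpha : K; bq_beta : K; bq_gamma : K; bq_b2 : K;
  bq_lambda : K; bq_mu : K; bq_nu : K; bq_b3 : K }.

Definition bq_relations (K : fieldType) (P : bq_params K) (A : algType K)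
    (x : 'I_3 -> A) : Prop :=
  [/\ x 1 * x 0 - bq_q1 P *: (x 0 * x 1) =
        bq_a P *: x 0 + bq_b P *: x 1 + bq_c P *: x 2 + (bq_b1 P)%:A,
      x 2 * x 0 - bq_q2 P *: (x 0 * x 2) =
        bq_alpha P *: x 0 + bq_beta P *: x 1 + bq_gamma P *: x 2
        + (bq_b2 P)%:A
    & x 2 * x 1 - bq_q3 P *: (x 1 * x 2) =
        bq_lambda P *: x 0 + bq_mu P *: x 1 + bq_nu P *: x 2 + (bq_b3 P)%:A].

(* A = K<x_1, x_2, x_3> / (relations), expressed by its universal property. *)
Definition bq_presented (K : fieldType) (P : bq_params K) (A : algType K)
    (x : 'I_3 -> A) : Prop :=
  bq_relations P x /\
  forall (B : algType K) (y : 'I_3 -> B), bq_relations P y ->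
    exists f : {lrmorphism A -> B}, (forall i, f (x i) = y i) /\
      forall g : {lrmorphism A -> B}, (forall i, g (x i) = y i) -> g =1 f.

Definition pbw_sum (K : fieldType) (A : algType K) (x : 'I_3 -> A) (n : nat)
    (u : nat -> nat -> nat -> K) : A :=
  \sum_(i < n) \sum_(j < n) \sum_(k < n)
    u i j k *: (x 0 ^+ i * x 1 ^+ j * x 2 ^+ k).

Definition pbw_basis (K : fieldType) (A : algType K) (x : 'I_3 -> A) : Prop :=
  (forall a : A, exists (n : nat) (u : nat -> nat -> nat -> K),
     a = pbw_sum x n u) /\
  (forall (n : nat) (u : nat -> nat -> nat -> K), pbw_sum x n u = 0 ->
     forall i j k, (i < n)%N -> (j < n)%N -> (k < n)%N -> u i j k = 0).

Definition biquadratic (K : fieldType) (P : bq_params K) (A : algType K)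
    (x : 'I_3 -> A) : Prop :=
  [/\ [/\ bq_q1 P != 0, bq_q2 P != 0 & bq_q3 P != 0],
      bq_presented P x & pbw_basis x].

Definition quantum_biquadratic (K : fieldType) (q : K) (A : algType K)
    (x : 'I_3 -> A) : Prop :=
  q != 1 /\ exists P : bq_params K,
    [/\ biquadratic P x, bq_q1 P = q, (bq_q2 P)^-1 = q & bq_q3 P = q].

Definition affine_change (K : fieldType) (A : algType K) (x y : 'I_3 -> A) :
    Prop :=
  exists l m : 'I_3 -> K, (forall i, l i != 0) /\
    forall i, y i = l i *: x i + (m i)%:A.

Definition perm_change (K : fieldType) (A : algType K) (x y : 'I_3 -> A) :
    Prop :=
  exists s : 'S_3, forall i, y i = x (s i).

(* G3_change x y: y is obtained from x by an element of G_3'. Both kinds of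
   generators of G_3' are closed under inverses, so products suffice. *)
Inductive G3_change (K : fieldType) (A : algType K) (x : 'I_3 -> A) :
    ('I_3 -> A) -> Prop :=
| G3_refl : G3_change x x
| G3_affine y z : G3_change x y -> affine_change y z -> G3_change x z
| G3_perm y z : G3_change x y -> perm_change y z -> G3_change x z.

Record nf_params (K : fieldType) := NfParams {
  nf_c : K; nf_beta : K; nf_lambda : K; nf_b1 : K; nf_b2 : K; nf_b3 : K }.

(* x_2 x_1 = q x_1 x_2 + c x_3 + b_1,  x_3 x_1 = q^-1 x_1 x_3 + beta x_2 + b_2,
   x_3 x_2 = q x_2 x_3 + lambda x_1 + b_3. *)
Definition nf_bq (K : fieldType) (q : K) (d : nf_params K) : bq_params K :=
  {| bq_q1 := q; bq_q2 := q^-1; bq_q3 := q;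
     bq_a := 0; bq_b := 0; bq_c := nf_c d; bq_b1 := nf_b1 d;
     bq_alpha := 0; bq_beta := nf_beta d; bq_gamma := 0; bq_b2 := nf_b2 d;
     bq_lambda := nf_lambda d; bq_mu := 0; bq_nu := 0; bq_b3 := nf_b3 d |}.

(* T is a complete set of representatives of K^* / (K^* )^n. *)
Definition power_class_reps (K : fieldType) (n : nat) (T : K -> Prop) : Prop :=
  (forall t, T t -> t != 0) /\
  forall mu : K, mu != 0 ->
    exists! t : K, T t /\ exists xi : K, xi != 0 /\ t = mu * xi ^+ n.

Inductive nf_case := Case1 | Case2 | Case3 | Case4.

(* The parameters of a normal form that are listed as a triple in each case. *)
Definition case_triple (K : fieldType) (k : nf_case) (d : nf_params K) :
    K * K * K :=
  match k with
  | Case1 => (nf_c d, nf_beta d, nf_lambda d)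
  | Case2 => (nf_c d, nf_beta d, nf_b3 d)
  | Case3 => (nf_c d, nf_b2 d, nf_b3 d)
  | Case4 => (nf_b1 d, nf_b2 d, nf_b3 d)
  end.

(* T n stands for K^* / (K^* )^n; the parameters that are not mentioned range
   over K. *)
Definition in_case (K : fieldType) (T : nat -> K -> Prop) (k : nf_case)
    (d : nf_params K) : Prop :=
  let t := case_triple k d in
  match k with
  | Case1 =>
      exists mu nu, [/\ T 2%N mu, T 2%N nu & t = (1, mu, nu)]
  | Case2 =>
      nf_lambda d = 0 /\
      ((exists mu, T 4%N mu /\ t = (1, mu, 1)) \/
       (exists mu, T 2%N mu /\ t = (1, mu, 0)))
  | Case3 =>
      [/\ nf_beta d = 0, nf_lambda d = 0
        & (exists mu, T 3%N mu /\ t = (1, 1, mu)) \/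
          t = (1, 1, 0) \/ t = (1, 0, 0)]
  | Case4 =>
      [/\ nf_c d = 0, nf_beta d = 0, nf_lambda d = 0
        & (exists mu, T 2%N mu /\ t = (1, 1, mu)) \/
          t = (1, 1, 0) \/ t = (1, 0, 0) \/ t = (0, 0, 0)]
  end.

Inductive nf_type :=
| Type1 | Type2_b3_0 | Type2_b3_1
| Type3_11 | Type3_10 | Type3_00
| Type4_111 | Type4_110 | Type4_100 | Type4_000.

Definition in_type (K : fieldType) (t : nf_type) (d : nf_params K) : Prop :=
  let: NfParams c beta lambda b1 b2 b3 := d in
  match t with
  | Type1      => (c, beta, lambda) = (1, 1, 1)
  | Type2_b3_0 => (c, beta, lambda) = (1, 1, 0) /\ b3 = 0
  | Type2_b3_1 => (c, beta, lambda) = (1, 1, 0) /\ b3 = 1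
  | Type3_11   => (c, beta, lambda) = (1, 0, 0) /\ (b2, b3) = (1, 1)
  | Type3_10   => (c, beta, lambda) = (1, 0, 0) /\ (b2, b3) = (1, 0)
  | Type3_00   => (c, beta, lambda) = (1, 0, 0) /\ (b2, b3) = (0, 0)
  | Type4_111  => (c, beta, lambda) = (0, 0, 0) /\ (b1, b2, b3) = (1, 1, 1)
  | Type4_110  => (c, beta, lambda) = (0, 0, 0) /\ (b1, b2, b3) = (1, 1, 0)
  | Type4_100  => (c, beta, lambda) = (0, 0, 0) /\ (b1, b2, b3) = (1, 0, 0)
  | Type4_000  => (c, beta, lambda) = (0, 0, 0) /\ (b1, b2, b3) = (0, 0, 0)
  end.

(* Main.v *)
(* In the PBW basis, resolving x_3 x_2 x_1 in two ways forces nu = a, mu = - q alpha and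
   b = - q gamma, so that, as q <> 1, a unique shift of each generator removes all linear terms
   except c x_3, beta x_2 and lambda x_1. The remaining freedom consists of rescalings, under
   which (c, b1), (beta, b2), (lambda, b3) are multiplied by nonzero scalars, and permutations,
   which permute these three pairs and may invert q. Hence the numbers of pairs with nonzero
   linear part, and with zero linear but nonzero constant part, are invariants; sorting the pairs
   and rescaling gives the list.
   That every choice of parameters has a PBW basis is shown by letting x_1, x_2, x_3 act on
   K[X_1, X_2, X_3] as left multiplication on ordered monomials should. These operators satisfy
   the relations, so an ordered polynomial is multiplied by substituting the operators into it;
   associativity is then a case of the universal property. The same algebra gives the PBW basis
   of any algebra presented in normal form, in particular after a permutation of generators. *)

Require Import Defs.
From HB Require Import structures.
From mathcomp Require Import all_boot all_order all_algebra all_fingroup.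
From mathcomp Require Import ssrcomplements mpoly ring zify.

Set Implicit Arguments.
Unset Strict Implicit.
Unset Printing Implicit Defensive.

Import GRing.Theory.
Local Open Scope ring_scope.

(** * Deciding linear identities in a module *)

Section LinearCombinations.

Variables (K : comNzRingType) (V : lmodType K).

Inductive lc_expr :=
  | LCAtom of nat
  | LCZero
  | LCAdd of lc_expr & lc_expr
  | LCOpp of lc_expr
  | LCScale of K & lc_expr.

Fixpoint lc_eval (env : seq V) (t : lc_expr) : V :=
  match t with
  | LCAtom i => nth 0 env i
  | LCZero => 0
  | LCAdd t1 t2 => lc_eval env t1 + lc_eval env t2
  | LCOpp t1 => - lc_eval env t1
  | LCScale a t1 => a *: lc_eval env t1
  end.

Fixpoint lc_coef (i : nat) (t : lc_expr) : K :=
  match t with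
  | LCAtom j => if Nat.eqb j i then 1 else 0
  | LCZero => 0
  | LCAdd t1 t2 => lc_coef i t1 + lc_coef i t2
  | LCOpp t1 => - lc_coef i t1
  | LCScale a t1 => a * lc_coef i t1
  end.

(** A conjunction built by recursion, so that computation leaves exactly one scalar equation per
    atom. Equality of the coefficients suffices even when the atoms are linearly dependent. *)
Fixpoint lc_coefs_eq (n : nat) (t1 t2 : lc_expr) : Prop :=
  if n is i.+1 then lc_coef i t1 = lc_coef i t2 /\ lc_coefs_eq i t1 t2 else True.

Lemma lc_evalE env t :
  lc_eval env t = \sum_(i < size env) lc_coef i t *: nth 0 env i.
Proof.
elim: t => [j||t1 IH1 t2 IH2|t1 IH1|a t1 IH1] /=.
- have [lt_j|ge_j] := ltnP j (size env); last first.
    rewrite nth_default // big1 // => i _; case: PeanoNat.Nat.eqb_spec => [ji|_].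
      by rewrite ji leqNgt ltn_ord in ge_j.
    by rewrite scale0r.
  rewrite (bigD1 (Ordinal lt_j)) //= PeanoNat.Nat.eqb_refl scale1r big1 ?addr0 // => i.
  case: PeanoNat.Nat.eqb_spec => [ji|_ _]; last by rewrite scale0r.
  by case/eqP; apply: val_inj.
- by rewrite big1 // => i _; rewrite scale0r.
- by rewrite IH1 IH2 -big_split; apply: eq_bigr => i _; rewrite scalerDl.
- by rewrite IH1 -sumrN; apply: eq_bigr => i _; rewrite scaleNr.
- by rewrite IH1 scaler_sumr; apply: eq_bigr => i _; rewrite scalerA.
Qed.

Lemma lc_eq env t1 t2 :
  lc_coefs_eq (size env) t1 t2 -> lc_eval env t1 = lc_eval env t2.
Proof.
move=> h; rewrite !lc_evalE; elim: (size env) h => [|n IHn] /=; first by rewrite !big_ord0.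
by case=> en /IHn IH; rewrite !big_ord_recr /= IH en.
Qed.

End LinearCombinations.

(** The inner [match] runs [unify] while a term is being built; if it fails, the search backtracks
    to the tail of the list. *)
Ltac lc_mem x l :=
  lazymatch l with
  | nil => constr:(false)
  | cons ?y ?l' =>
      match constr:(tt) with
      | _ => let _ := match constr:(tt) with _ => unify x y end in constr:(true)
      | _ => lc_mem x l'
      end
  end.

Ltac lc_atoms t env :=
  lazymatch t with
  | @Algebra.add _ ?x ?y => let env' := lc_atoms x env in lc_atoms y env'
  | @Algebra.opp _ ?x => lc_atoms x env
  | @GRing.scale _ _ _ ?x => lc_atoms x env
  | @Algebra.zero _ => env
  | _ => lazymatch lc_mem t env with
         | true => env
         | false => constr:(cons t env)
         end
  end.

Ltac lc_index x l :=
  lazymatch l with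
  | cons ?y ?l' =>
      match constr:(tt) with
      | _ => let _ := match constr:(tt) with _ => unify x y end in constr:(O)
      | _ => let n := lc_index x l' in constr:(S n)
      end
  end.

Ltac lc_reify K t env :=
  lazymatch t with
  | @Algebra.add _ ?x ?y =>
      let u := lc_reify K x env in let v := lc_reify K y env in
      constr:(@LCAdd K u v)
  | @Algebra.opp _ ?x => let u := lc_reify K x env in constr:(@LCOpp K u)
  | @GRing.scale _ _ ?a ?x => let u := lc_reify K x env in constr:(@LCScale K a u)
  | @Algebra.zero _ => constr:(@LCZero K)
  | _ => let n := lc_index t env in constr:(@LCAtom K n)
  end.

(** Products in an algebra count as atoms and have to be expanded beforehand. The resulting scalar
    equations are left to [ring] or [field]. *)
Ltac linear_combination K :=
  lazymatch goal with
  | |- @eq ?T ?x ?y =>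
      let env0 := lc_atoms x (@nil T) in
      let env := lc_atoms y env0 in
      let t1 := lc_reify K x env in
      let t2 := lc_reify K y env in
      apply: (@lc_eq K _ env t1 t2);
      cbv [lc_coefs_eq lc_coef Nat.eqb size]; do ?split
  end.

(** * Operators on ordered polynomials *)

Definition mon3 (i j k : nat) : 'X_{1..3} := Multinom [tuple i; j; k].

Lemma mon3E (m : 'X_{1..3}) : mon3 (m 0) (m 1) (m 2) = m.
Proof.
apply/mnmP=> i; case: i => [[|[|[|i]]] hi] //;
  by rewrite /mon3 multinomE (tnth_nth 0%N) /=; congr (m _); apply/val_inj.
Qed.

Lemma mon3_0 i j k : mon3 i j k 0 = i. Proof. by rewrite multinomE (tnth_nth 0%N). Qed.
Lemma mon3_1 i j k : mon3 i j k 1 = j. Proof. by rewrite multinomE (tnth_nth 0%N). Qed.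
Lemma mon3_2 i j k : mon3 i j k 2 = k. Proof. by rewrite multinomE (tnth_nth 0%N). Qed.

Lemma mdeg3 (m : 'X_{1..3}) : mdeg m = (m 0%R + m 1%R + m 2%R)%N.
Proof.
by rewrite mdegE !big_ord_recl big_ord0 addn0 addnA; congr (m _ + m _ + m _)%N; apply/val_inj.
Qed.

Lemma mdeg_mon3 i j k : mdeg (mon3 i j k) = (i + j + k)%N.
Proof. by rewrite mdeg3 mon3_0 mon3_1 mon3_2. Qed.

Section LinearExtension.

Variable K : fieldType.
Local Notation V := {mpoly K[3]}.

Definition pbw_mon i j k : V := 'X_[mon3 i j k].

Lemma mulX0_pbw_mon i j k : 'X_0 * pbw_mon i j k = pbw_mon i.+1 j k.
Proof.
rewrite /pbw_mon -mpolyXD; congr 'X_[_]; rewrite -[RHS]mon3E -[LHS]mon3E.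
by rewrite !mnmDE !mnm1E !(mon3_0, mon3_1, mon3_2).
Qed.

Definition lin_ext (W : lmodType K) (F : nat -> nat -> nat -> W) (p : V) : W :=
  \sum_(m <- msupp p) p@_m *: F (m 0) (m 1) (m 2).

Section Ext.
Variables (W : lmodType K) (F : nat -> nat -> nat -> W).

(** Replaces the support of [p] by an index set depending only on a degree bound, so that sums for
    different polynomials can be added termwise. *)
Lemma lin_extE n p : (msize p <= n)%N ->
  lin_ext F p = \sum_(m : 'X_{1..3 < n}) p@_m *: F (m 0) (m 1) (m 2).
Proof.
move=> hn; rewrite /lin_ext (big_mksub 'X_{1..3 < n}) ?msupp_uniq //=; last first.
  by move=> m mp; apply: leq_trans (msize_mdeg_lt mp) hn.
by rewrite big_rmcond //= => m /memN_msupp_eq0 ->; rewrite scale0r.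
Qed.

Lemma lin_ext_linear : linear (lin_ext F).
Proof.
move=> a p r; pose n := maxn (msize (a *: p + r)) (maxn (msize p) (msize r)).
rewrite !(@lin_extE n) ?leq_max ?leqnn ?orbT // scaler_sumr -big_split /=.
by apply: eq_bigr => m _; rewrite mcoeffD mcoeffZ scalerDl scalerA.
Qed.

HB.instance Definition _ := GRing.isLinear.Build K V W _ (lin_ext F) lin_ext_linear.

Lemma lin_ext_mon i j k : lin_ext F (pbw_mon i j k) = F i j k.
Proof.
by rewrite /lin_ext msuppX big_seq1 mcoeffX eqxx scale1r mon3_0 mon3_1 mon3_2.
Qed.

End Ext.

Lemma pbw_monE (p : V) :
  p = \sum_(m <- msupp p) p@_m *: pbw_mon (m 0) (m 1) (m 2).
Proof. by rewrite [LHS]mpolyE; apply: eq_bigr => m _; rewrite /pbw_mon mon3E. Qed.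

Lemma pbw_mon_ind (P : V -> Prop) :
  P 0 -> (forall i j k, P (pbw_mon i j k)) ->
  (forall a p r, P p -> P r -> P (a *: p + r)) -> forall p, P p.
Proof.
move=> P0 Pm PD p; rewrite (pbw_monE p); elim/big_rec: _ => // m r _ Pr.
exact: PD.
Qed.

(** The operators below are built by recursion on the degree; during an induction two maps are known
    to agree only in bounded degree. *)
Lemma eq_linear_deg (W : lmodType K) (f g : {linear V -> W}) n :
  (forall i j k, (i + j + k < n)%N -> f (pbw_mon i j k) = g (pbw_mon i j k)) ->
  forall p, (msize p <= n)%N -> f p = g p.
Proof.
move=> fg p pn; rewrite (pbw_monE p) !linear_sum; apply: eq_big_seq => m mp.
rewrite !linearZ; congr (_ *: _); apply: fg; rewrite -mdeg3.
exact: leq_trans (msize_mdeg_lt mp) pn.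
Qed.

Lemma msize_sum_le n (I : eqType) (s : seq I) (f : I -> V) :
  (forall i, i \in s -> (msize (f i) <= n)%N) -> (msize (\sum_(i <- s) f i) <= n)%N.
Proof.
move=> h; rewrite big_seq; elim/big_ind: _ => [|p r hp hr|i /h //]; first by rewrite msize0.
by apply: leq_trans (msizeD_le _ _) _; rewrite geq_max hp.
Qed.

Lemma msize_pbw_mon i j k : msize (pbw_mon i j k) = (i + j + k).+1.
Proof. by rewrite msizeX mdeg_mon3. Qed.

Lemma msize_mulX0_le (p : V) n : (msize p <= n)%N -> (msize ('X_0 * p)%R <= n.+1)%N.
Proof.
have [->|p0] := eqVneq p 0; first by rewrite mulr0 msize0.
rewrite msizeM //; first by rewrite msizeX mdeg1 !addSn add0n.
by rewrite -msize_poly_eq0 msizeX.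
Qed.

Lemma msizeZ_le_trans (a : K) (p : V) n : (msize p <= n)%N -> (msize (a *: p) <= n)%N.
Proof. by move=> pn; apply: leq_trans (msizeZ_le _ _) pn. Qed.

Lemma msizeD_le_trans (p r : V) n :
  (msize p <= n)%N -> (msize r <= n)%N -> (msize (p + r) <= n)%N.
Proof. by move=> pn rn; apply: leq_trans (msizeD_le _ _) _; rewrite geq_max pn. Qed.

End LinearExtension.

(** * Action of the generators on ordered polynomials *)

Section Algebra.

Variables (K : fieldType) (q : K) (d : nf_params K).
Local Notation V := {mpoly K[3]}.
Local Notation e := (@pbw_mon K).
Local Notation c := (nf_c d).
Local Notation beta := (nf_beta d).
Local Notation lambda := (nf_lambda d).
Local Notation b1 := (nf_b1 d).
Local Notation b2 := (nf_b2 d).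
Local Notation b3 := (nf_b3 d).

(* Left multiplication of x_1^i x_2^j x_3^k by x_2 and x_3, given these products in lower total
   degree. For i = 0 the leading term of x_3 x_2^j' x_3^k is split off: x_2 sends it to an
   ordered monomial, and the rest has degree at most j' + k. *)
Definition nf_act_step (F : nat -> nat -> nat -> V * V) (i j k : nat) : V * V :=
  match i, j with
  | i'.+1, _ =>
      (q *: ('X_0 * (F i' j k).1) + c *: (F i' j k).2 + b1 *: e i' j k,
       q^-1 *: ('X_0 * (F i' j k).2) + beta *: (F i' j k).1 + b2 *: e i' j k)
  | 0%N, j'.+1 =>
      (e 0 j.+1 k,
       q ^+ j *: e 0 j k.+1
       + q *: lin_ext (fun i j k => (F i j k).1)
                ((F 0%N j' k).2 - q ^+ j' *: e 0 j' k.+1)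
       + lambda *: e 1 j' k + b3 *: e 0 j' k)
  | 0%N, 0%N => (e 0 1 k, e 0 0 k.+1)
  end.

(* Valid in total degree < n only, with junk value 0 elsewhere. *)
Fixpoint nf_act_table (n : nat) (i j k : nat) : V * V :=
  if n is n'.+1 then
    if (i + j + k == n')%N then nf_act_step (nf_act_table n') i j k
    else nf_act_table n' i j k
  else (0, 0).

Definition nf_act_mon i j k := nf_act_table (i + j + k).+1 i j k.

Lemma nf_act_tableE n i j k :
  (i + j + k < n)%N -> nf_act_table n i j k = nf_act_mon i j k.
Proof.
elim: n => // n IHn; rewrite ltnS leq_eqVlt => /orP[/eqP <-//|lt_n].
by rewrite /= ltn_eqF // IHn.
Qed.

Arguments nf_act_table : simpl never.

Lemma nf_act_monE i j k : nf_act_mon i j k = nf_act_step (nf_act_table (i + j + k)) i j k.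
Proof. by rewrite /nf_act_mon [LHS]/nf_act_table eqxx. Qed.

Definition nf_act1 (p : V) : V := 'X_0 * p.
Definition nf_act2 (p : V) : V := lin_ext (fun i j k => (nf_act_mon i j k).1) p.
Definition nf_act3 (p : V) : V := lin_ext (fun i j k => (nf_act_mon i j k).2) p.

Lemma nf_act1_linear : linear nf_act1.
Proof. by move=> a p r; rewrite /nf_act1 mulrDr scalerAr. Qed.
HB.instance Definition _ := GRing.isLinear.Build K V V _ nf_act1 nf_act1_linear.
HB.instance Definition _ := GRing.Linear.copy nf_act2 (lin_ext (fun i j k => (nf_act_mon i j k).1)).
HB.instance Definition _ := GRing.Linear.copy nf_act3 (lin_ext (fun i j k => (nf_act_mon i j k).2)).

Lemma nf_act_monS i j k : nf_act_mon i.+1 j k =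
  (q *: ('X_0 * (nf_act_mon i j k).1) + c *: (nf_act_mon i j k).2 + b1 *: e i j k,
   q^-1 *: ('X_0 * (nf_act_mon i j k).2) + beta *: (nf_act_mon i j k).1 + b2 *: e i j k).
Proof. by rewrite nf_act_monE /nf_act_step nf_act_tableE //; lia. Qed.

Lemma nf_act_mon0S j k : nf_act_mon 0 j.+1 k =
  (e 0 j.+2 k,
   q ^+ j.+1 *: e 0 j.+1 k.+1
   + q *: lin_ext (fun i j' k' => (nf_act_table (j.+1 + k) i j' k').1)
            ((nf_act_mon 0 j k).2 - q ^+ j *: e 0 j k.+1)
   + lambda *: e 1 j k + b3 *: e 0 j k).
Proof.
by rewrite nf_act_monE add0n /nf_act_step nf_act_tableE ?add0n ?addSn.
Qed.

(** Each operator raises the degree by at most one, and on [x_2^j x_3^k] the operator of [x_3] has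
    leading term [q^j x_2^j x_3^(k+1)]. The last clause shows that the recursive call in
    [nf_act_step] stays where the table is not junk. Note that [msize] is the degree plus one. *)
Lemma nf_act_mon_bound n i j k : (i + j + k < n)%N ->
  [/\ (msize (nf_act_mon i j k).1 <= (i + j + k).+2)%N,
      (msize (nf_act_mon i j k).2 <= (i + j + k).+2)%N
    & i = 0%N -> (msize ((nf_act_mon i j k).2 - q ^+ j *: e i j k.+1)%R <= (i + j + k).+1)%N].
Proof.
elim: n i j k => // n IHn i j k; rewrite ltnS.
case: i => [|i] le_n; last first.
  have [|s1 s2 _] := IHn i j k; first by lia.
  rewrite nf_act_monS; split=> //=; do 2?apply: msizeD_le_trans; apply: msizeZ_le_trans;
    rewrite ?msize_pbw_mon ?addSn //; try exact: msize_mulX0_le; lia.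
case: j le_n => [|j] le_n.
  rewrite nf_act_monE /= expr0 scale1r subrr msize0 !msize_pbw_mon; split=> //; lia.
have [|s1 s2 /(_ erefl) s3] := IHn 0%N j k; first by lia.
rewrite nf_act_mon0S /=.
set G := (_ - _) in s3 *; set H := lin_ext _ G.
have sH : (msize H <= (0 + j.+1 + k).+1)%N.
  apply: msize_sum_le => m mG; apply: msizeZ_le_trans.
  have := leq_trans (msize_mdeg_lt mG) s3; rewrite mdeg3 => mlt.
  (* The monomials of [G] have degree at most [j + k], just within the range of the table of height
     [j + 1 + k]. *)
  rewrite (@nf_act_tableE (j.+1 + k)); last by lia.
  by have [|s _ _] := IHn (m 0) (m 1) (m 2); [lia|apply: leq_trans s _; lia].
split=> [||_].
- by rewrite msize_pbw_mon; lia.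
- do 3?apply: msizeD_le_trans; apply: msizeZ_le_trans; rewrite ?msize_pbw_mon; lia.
- rewrite -!addrA addrC !addrA subrK.
  do 3?apply: msizeD_le_trans; apply: msizeZ_le_trans; rewrite ?msize_pbw_mon; lia.
Qed.

Lemma nf_act2_mon0 j k : nf_act2 (e 0 j k) = e 0 j.+1 k.
Proof. by rewrite /nf_act2 lin_ext_mon nf_act_monE; case: j. Qed.

Lemma nf_act3_mon00 k : nf_act3 (e 0 0 k) = e 0 0 k.+1.
Proof. by rewrite /nf_act3 lin_ext_mon nf_act_monE. Qed.

Lemma nf_act2_mulX0 p : nf_act2 ('X_0 * p) = q *: ('X_0 * nf_act2 p) + c *: nf_act3 p + b1 *: p.
Proof.
elim/pbw_mon_ind: p => [|i j k|a p r IHp IHr].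
- by rewrite mulr0 !linear0 mulr0 !scaler0 !addr0.
- by rewrite mulX0_pbw_mon /nf_act2 /nf_act3 !lin_ext_mon nf_act_monS.
rewrite mulrDr -scalerAr !linearP /= IHp IHr mulrDr -scalerAr.
by linear_combination K; ring.
Qed.

Lemma nf_act3_mulX0 p : nf_act3 ('X_0 * p) = q^-1 *: ('X_0 * nf_act3 p) + beta *: nf_act2 p + b2 *: p.
Proof.
elim/pbw_mon_ind: p => [|i j k|a p r IHp IHr].
- by rewrite mulr0 !linear0 mulr0 !scaler0 !addr0.
- by rewrite mulX0_pbw_mon /nf_act2 /nf_act3 !lin_ext_mon nf_act_monS.
rewrite mulrDr -scalerAr !linearP /= IHp IHr mulrDr -scalerAr.
by linear_combination K; ring.
Qed.

Lemma nf_act3_deg j k :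
  (msize (nf_act3 (e 0 j k) - q ^+ j *: e 0 j k.+1)%R <= (j + k).+1)%N.
Proof.
by rewrite /nf_act3 lin_ext_mon; have [|_ _ /(_ erefl)] := @nf_act_mon_bound (j + k).+1 0 j k.
Qed.

Lemma nf_act32_mon0 j k :
  nf_act3 (nf_act2 (e 0 j k)) =
  q *: nf_act2 (nf_act3 (e 0 j k)) + lambda *: e 1 j k + b3 *: e 0 j k.
Proof.
rewrite nf_act2_mon0 {1}/nf_act3 lin_ext_mon nf_act_mon0S /=.
have -> : (nf_act_mon 0 j k).2 = nf_act3 (e 0 j k) by rewrite /nf_act3 lin_ext_mon.
(* The argument has lost its leading term, so the table acts on it as [nf_act2] does; the leading
   term split off in the definition is then put back by linearity. *)
rewrite (@eq_linear_deg _ _ (lin_ext _) nf_act2 (j + k).+1) ?nf_act3_deg //; last first.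
  by move=> i' j' k' lt_n; rewrite /= /nf_act2 !lin_ext_mon nf_act_tableE // addSn.
rewrite linearB linearZ /= nf_act2_mon0.
by linear_combination K; rewrite ?exprS; ring.
Qed.

Hypothesis q0 : q != 0.

(** For [i = 0] the relation is built into the definition of [nf_act3]. Multiplication by ['X_0]
    preserves it: this is the resolution of the overlap [x_3 x_2 x_1], where [q * q^-1 = 1] is
    used. *)
Lemma nf_act32 p :
  nf_act3 (nf_act2 p) = q *: nf_act2 (nf_act3 p) + lambda *: ('X_0 * p) + b3 *: p.
Proof.
elim/pbw_mon_ind: p => [|i j k|a p r IHp IHr].
- by rewrite !(linear0, mulr0, scaler0, addr0).
- elim: i => [|i IHi]; first by rewrite nf_act32_mon0 mulX0_pbw_mon.
  rewrite -mulX0_pbw_mon; move: (e i j k) IHi => p IHp.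
  rewrite nf_act2_mulX0 nf_act3_mulX0 !linearD !linearZ /= nf_act3_mulX0 nf_act2_mulX0 IHp.
  rewrite !mulrDr -!scalerAr.
  by linear_combination K; field.
rewrite !linearP /= IHp IHr mulrDr -scalerAr.
by linear_combination K; ring.
Qed.

(** The defining relations for operators on any module, so that they apply both to the action on
    polynomials and to left multiplications in an algebra. *)
Definition nf_act_rel (W : lmodType K) (y1 y2 y3 : W -> W) : Prop :=
  forall w,
  [/\ y2 (y1 w) = q *: y1 (y2 w) + c *: y3 w + b1 *: w,
      y3 (y1 w) = q^-1 *: y1 (y3 w) + beta *: y2 w + b2 *: w
    & y3 (y2 w) = q *: y2 (y3 w) + lambda *: y1 w + b3 *: w].

Lemma nf_act_relP : nf_act_rel nf_act1 nf_act2 nf_act3.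
Proof. by move=> p; split; [apply: nf_act2_mulX0|apply: nf_act3_mulX0|apply: nf_act32]. Qed.

(** * Maps from ordered polynomials to other modules with such operators *)

Section Universal.

Variables (W : lmodType K) (y1 y2 y3 : {linear W -> W}) (w0 : W).
Hypothesis yrel : nf_act_rel y1 y2 y3.

Definition pbw_orbit i j k : W := iter i y1 (iter j y2 (iter k y3 w0)).
Definition pbw_orbit_map : V -> W := lin_ext pbw_orbit.
HB.instance Definition _ := GRing.Linear.copy pbw_orbit_map (lin_ext pbw_orbit).

Lemma pbw_orbit_map_mulX0 p : pbw_orbit_map ('X_0 * p) = y1 (pbw_orbit_map p).
Proof.
elim/pbw_mon_ind: p => [|i j k|a p r IHp IHr].
- by rewrite mulr0 !linear0.
- by rewrite mulX0_pbw_mon /pbw_orbit_map !lin_ext_mon.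
by rewrite mulrDr -scalerAr !linearP /= IHp IHr.
Qed.

(** Induction on the degree. A leading [x_1] is moved out by the first two relations. Without it,
    [x_2] keeps the monomial ordered, and [x_3] is carried past one [x_2] by the third relation. *)
Lemma pbw_orbit_map_act_mon n i j k : (i + j + k < n)%N ->
  pbw_orbit_map (nf_act2 (e i j k)) = y2 (pbw_orbit_map (e i j k)) /\
  pbw_orbit_map (nf_act3 (e i j k)) = y3 (pbw_orbit_map (e i j k)).
Proof.
have orbE i' j' k' : pbw_orbit_map (e i' j' k') = pbw_orbit i' j' k' by exact: lin_ext_mon.
elim: n i j k => // n IHn i j k; rewrite ltnS.
case: i => [|i] le_n; last first.
  have [|IH2 IH3] := IHn i j k; first by lia.
  rewrite -mulX0_pbw_mon nf_act2_mulX0 nf_act3_mulX0 !linearD !linearZ /=.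
  rewrite !pbw_orbit_map_mulX0 IH2 IH3.
  by have [-> -> _] := yrel (pbw_orbit_map (e i j k)).
split; first by rewrite nf_act2_mon0 !orbE.
case: j le_n => [|j] le_n; first by rewrite nf_act3_mon00 !orbE.
have [|_ IH3] := IHn 0%N j k; first by lia.
(* [nf_act3 (e 0 j k)] may have degree [j + k + 1], beyond the induction hypothesis. Its leading
   term is an ordered monomial without [x_1], for which the claim is immediate; the rest [G] has
   degree at most [j + k]. *)
have IHG : pbw_orbit_map (nf_act2 (nf_act3 (e 0 j k))) = y2 (pbw_orbit_map (nf_act3 (e 0 j k))).
  have [G -> IHG] : exists2 G, nf_act3 (e 0 j k) = G + q ^+ j *: e 0 j k.+1
                     & pbw_orbit_map (nf_act2 G) = y2 (pbw_orbit_map G).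
    exists (nf_act3 (e 0 j k) - q ^+ j *: e 0 j k.+1); first by rewrite subrK.
    apply: (@eq_linear_deg _ _ (pbw_orbit_map \o nf_act2) (y2 \o pbw_orbit_map) (j + k).+1) _ _ (nf_act3_deg j k).
    by move=> i' j' k' lt_n; have [|/=] := IHn i' j' k'; first by lia.
  rewrite !linearD !linearZ /= IHG nf_act2_mon0; congr (_ + _ *: _).
  by rewrite !orbE.
rewrite -nf_act2_mon0 nf_act32 !linearD !linearZ /= IHG IH3 pbw_orbit_map_mulX0.
have -> : pbw_orbit_map (nf_act2 (e 0 j k)) = y2 (pbw_orbit_map (e 0 j k)) by rewrite nf_act2_mon0 !orbE.
by have [_ _ ->] := yrel (pbw_orbit_map (e 0 j k)).
Qed.

Lemma pbw_orbit_map_act p :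
  pbw_orbit_map (nf_act2 p) = y2 (pbw_orbit_map p) /\ pbw_orbit_map (nf_act3 p) = y3 (pbw_orbit_map p).
Proof.
elim/pbw_mon_ind: p => [|i j k|a p r [IHp2 IHp3] [IHr2 IHr3]].
- by rewrite !linear0.
- exact: (@pbw_orbit_map_act_mon (i + j + k).+1).
by rewrite !linearP /= IHp2 IHr2 IHp3 IHr3.
Qed.

End Universal.

End Algebra.

(** * The algebra of a normal form *)

(* [q0] is recorded in the type because multiplication is associative only for invertible [q]. *)
Definition nf_algebra (K : fieldType) (q : K) (d : nf_params K) (q0 : q != 0) : Type :=
  {mpoly K[3]}.

Definition lmul (K : fieldType) (A : algType K) (a x : A) : A := a * x.

Lemma lmul_linear (K : fieldType) (A : algType K) (a : A) : linear (lmul a).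
Proof. by move=> k x y; rewrite /lmul mulrDr scalerAr. Qed.

HB.instance Definition _ (K : fieldType) (A : algType K) (a : A) :=
  GRing.isLinear.Build K A A _ (lmul a) (lmul_linear a).

Lemma iter_lmul (K : fieldType) (A : algType K) (a x : A) n :
  iter n (lmul a) x = a ^+ n * x.
Proof. by elim: n => [|n IHn] /=; rewrite ?mul1r // IHn /lmul exprS mulrA. Qed.

Section NormalFormAlgebra.

Variables (K : fieldType) (q : K) (d : nf_params K).
Hypothesis q0 : q != 0.
Local Notation V := {mpoly K[3]}.
Local Notation e := (@pbw_mon K).
Local Notation nf_act2 := (nf_act2 q d).
Local Notation nf_act3 := (nf_act3 q d).

(** The orbit map of [v]: the three operators are substituted into the ordered polynomial [u], and
    the result is applied to [v]. *)
Definition nf_mul (u v : V) : V := pbw_orbit_map (@nf_act1 K) nf_act2 nf_act3 v u.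

Lemma nf_mul_monl i j k v :
  nf_mul (e i j k) v = iter i (@nf_act1 K) (iter j nf_act2 (iter k nf_act3 v)).
Proof. exact: lin_ext_mon. Qed.

Lemma nf_mul_act1 u v : nf_mul (nf_act1 u) v = nf_act1 (nf_mul u v).
Proof. exact: pbw_orbit_map_mulX0. Qed.

Lemma nf_mul_act2 u v : nf_mul (nf_act2 u) v = nf_act2 (nf_mul u v).
Proof. by case: (pbw_orbit_map_act q0 v (nf_act_relP d q0) u). Qed.

Lemma nf_mul_act3 u v : nf_mul (nf_act3 u) v = nf_act3 (nf_mul u v).
Proof. by case: (pbw_orbit_map_act q0 v (nf_act_relP d q0) u). Qed.

Lemma nf_mul_linearl v : linear (nf_mul^~ v).
Proof. exact: lin_ext_linear. Qed.

Lemma iter_linear (f : {linear V -> V}) n : linear (iter n f).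
Proof. by elim: n => //= n IHn a u v; have /= -> := IHn a u v; rewrite linearP. Qed.

Lemma nf_mul_linearr u : linear (nf_mul u).
Proof.
move=> a v w; elim/pbw_mon_ind: u => [|i j k|b u u' IHu IHu'].
- by rewrite /nf_mul !linear0 addr0.
- by rewrite !nf_mul_monl !iter_linear.
by rewrite !nf_mul_linearl IHu IHu'; linear_combination K; ring.
Qed.

(** Right multiplication commutes with the three operators, and left multiplication by a monomial is
    a composite of them. *)
Lemma nf_mulA : associative nf_mul.
Proof.
move=> u v w; elim/pbw_mon_ind: u => [|i j k|a u u' IHu IHu'].
- by rewrite /nf_mul !linear0.
- rewrite !nf_mul_monl.
  elim: i => [|i IHi] /=; last by rewrite nf_mul_act1 IHi.
  elim: j => [|j IHj] /=; last by rewrite nf_mul_act2 IHj.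
  by elim: k => [|k IHk] //=; rewrite nf_mul_act3 IHk.
by rewrite !nf_mul_linearl IHu IHu'.
Qed.

Lemma nf_mul1 : left_id (e 0 0 0) nf_mul.
Proof. by move=> u; rewrite nf_mul_monl. Qed.

Lemma iter_act1 i j k : iter i (@nf_act1 K) (e 0 j k) = e i j k.
Proof. by elim: i => //= i ->; rewrite -mulX0_pbw_mon. Qed.

Lemma iter_act2 j k : iter j nf_act2 (e 0 0 k) = e 0 j k.
Proof. by elim: j => //= j ->; rewrite nf_act2_mon0. Qed.

Lemma iter_act3 k : iter k nf_act3 (e 0 0 0) = e 0 0 k.
Proof. by elim: k => //= k ->; rewrite nf_act3_mon00. Qed.

Lemma nf_mulr1 : right_id (e 0 0 0) nf_mul.
Proof.
move=> u; elim/pbw_mon_ind: u => [|i j k|a u u' IHu IHu'].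
- by rewrite /nf_mul !linear0.
- by rewrite nf_mul_monl iter_act3 iter_act2 iter_act1.
by rewrite nf_mul_linearl IHu IHu'.
Qed.

Lemma nf_mulDl : left_distributive nf_mul +%R.
Proof. by move=> u v w; have := nf_mul_linearl w 1 u v; rewrite !scale1r. Qed.

Lemma nf_mulDr : right_distributive nf_mul +%R.
Proof. by move=> u v w; have := nf_mul_linearr u 1 v w; rewrite !scale1r. Qed.

Lemma nf_one_neq0 : e 0 0 0 != 0.
Proof. by rewrite -msize_poly_eq0 msize_pbw_mon. Qed.

Lemma nf_scalerAl a u v : a *: nf_mul u v = nf_mul (a *: u) v.
Proof.
by have := nf_mul_linearl v a u 0; rewrite addr0 => ->; rewrite /nf_mul linear0 addr0.
Qed.

Lemma nf_scalerAr a u v : a *: nf_mul u v = nf_mul u (a *: v).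
Proof.
have n0 : nf_mul u 0 = 0.
  by have := nf_mul_linearr u (-1) 0 0; rewrite scaler0 addr0 scaleN1r addNr.
by have := nf_mul_linearr u a v 0; rewrite n0 !addr0.
Qed.

Local Notation A := (nf_algebra d q0).

(** Only the product is new: the module structure is that of polynomials. *)
HB.instance Definition _ := GRing.Lmodule.copy A V.
HB.instance Definition _ := GRing.Zmodule_isNzRing.Build A
  nf_mulA nf_mul1 nf_mulr1 nf_mulDl nf_mulDr nf_one_neq0.
HB.instance Definition _ := GRing.Lmodule_isLalgebra.Build K A nf_scalerAl.
HB.instance Definition _ := GRing.Lalgebra_isAlgebra.Build K A nf_scalerAr.



Definition nf_gen (i : 'I_3) : A :=
  match val i with 0%N => e 1 0 0 | 1%N => e 0 1 0 | _ => e 0 0 1 end.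

Lemma nf_gen0_mul (u : A) : nf_gen 0 * u = nf_act1 u.
Proof. exact: nf_mul_monl. Qed.
Lemma nf_gen1_mul (u : A) : nf_gen 1 * u = nf_act2 u.
Proof. exact: nf_mul_monl. Qed.
Lemma nf_gen2_mul (u : A) : nf_gen 2 * u = nf_act3 u.
Proof. exact: nf_mul_monl. Qed.

Lemma nf_gen_mon i j k :
  nf_gen 0 ^+ i * nf_gen 1 ^+ j * nf_gen 2 ^+ k = e i j k :> A.
Proof.
have expE (x : A) (f : V -> V) n : (forall u : A, x * u = f u) -> forall u : A, x ^+ n * u = iter n f u.
  by move=> xf u; elim: n => [|n IHn]; rewrite ?mul1r // exprS -mulrA xf IHn.
rewrite -[LHS]mulr1 -!mulrA (expE _ _ _ nf_gen2_mul) (expE _ _ _ nf_gen1_mul).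
by rewrite (expE _ _ _ nf_gen0_mul) iter_act3 iter_act2 iter_act1.
Qed.

End NormalFormAlgebra.

Lemma nf_act_rel_lmul (K : fieldType) (q : K) (d : nf_params K) (B : algType K) (y : 'I_3 -> B) :
  bq_relations (nf_bq q d) y -> nf_act_rel q d (lmul (y 0)) (lmul (y 1)) (lmul (y 2)).
Proof.
case=> /= r1 r2 r3 w; rewrite /lmul !mulrA; split.
- by  move/(canRL (subrK _)): r1 => ->; rewrite !mulrDl -!scalerAl !scale0r !mul1r; linear_combination K; ring.
- by move/(canRL (subrK _)): r2 => ->; rewrite !mulrDl -!scalerAl !scale0r !mul1r; linear_combination K; ring.
- by move/(canRL (subrK _)): r3 => ->; rewrite !mulrDl -!scalerAl !scale0r !mul1r; linear_combination K; ring.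
Qed.

(** * Universal property and PBW basis of the constructed algebra *)

Section NormalFormAlgebra.

Variables (K : fieldType) (q : K) (d : nf_params K).
Hypothesis q0 : q != 0.
Local Notation V := {mpoly K[3]}.
Local Notation e := (@pbw_mon K).
Local Notation A := (nf_algebra d q0).
Local Notation x := (nf_gen d q0).

Lemma nf_gen_relations : bq_relations (nf_bq q d) x.
Proof.
have [r1 r2 r3] := nf_act_relP d q0 (1 : A).
split; rewrite /= !scale0r -[x 0]mulr1 -[x 1]mulr1 -[x 2]mulr1 -!mulrA !mul1r.
- by rewrite !(nf_gen1_mul, nf_gen0_mul, nf_gen2_mul) r1; linear_combination K; ring.
- by rewrite !(nf_gen1_mul, nf_gen0_mul, nf_gen2_mul) r2; linear_combination K; ring.
- by rewrite !(nf_gen1_mul, nf_gen0_mul, nf_gen2_mul) r3; linear_combination K; ring.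
Qed.

Section Morphism.

Variables (B : algType K) (y : 'I_3 -> B).
Hypothesis yrel : bq_relations (nf_bq q d) y.

(** The orbit of [1] under left multiplications by the [y i]; ordered monomials go to ordered
    monomials. *)
Definition nf_lift : A -> B := pbw_orbit_map (lmul (y 0)) (lmul (y 1)) (lmul (y 2)) 1.

Lemma nf_lift_linear : linear nf_lift.
Proof. exact: lin_ext_linear. Qed.

Lemma nf_lift_mon i j k : nf_lift (e i j k) = y 0 ^+ i * y 1 ^+ j * y 2 ^+ k.
Proof. by rewrite /nf_lift /pbw_orbit_map lin_ext_mon /pbw_orbit !iter_lmul mulr1 mulrA. Qed.

Lemma nf_lift_act u :
  nf_lift (nf_act1 u) = y 0 * nf_lift u /\
  nf_lift (nf_act2 q d u) = y 1 * nf_lift u /\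
  nf_lift (nf_act3 q d u) = y 2 * nf_lift u.
Proof.
have [r2 r3] := pbw_orbit_map_act q0 1 (nf_act_rel_lmul yrel) u.
split=> //. exact: (pbw_orbit_map_mulX0 (lmul (y 0))).
Qed.

Lemma nf_lift_monoid_morphism : monoid_morphism nf_lift.
Proof.
split; first by rewrite [1]/(e 0 0 0) nf_lift_mon !mulr1.
move=> u v; have -> : u * v = nf_mul q d u v by [].
elim/pbw_mon_ind: u => [|i j k|a u u' IHu IHu'].
- by rewrite /nf_mul /nf_lift !linear0 mul0r.
- rewrite nf_mul_monl nf_lift_mon -!mulrA.
  elim: i => [|i IHi] /=; last by rewrite (proj1 (nf_lift_act _)) IHi exprS !mulrA.
  rewrite !mul1r; elim: j => [|j IHj] /=; last by rewrite (proj1 (proj2 (nf_lift_act _))) IHj exprS !mulrA.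
  rewrite !mul1r; elim: k => [|k IHk] /=; last by rewrite (proj2 (proj2 (nf_lift_act _))) IHk exprS !mulrA.
  by rewrite mul1r.
by rewrite nf_mul_linearl !nf_lift_linear IHu IHu' mulrDl scalerAl.
Qed.

HB.instance Definition _ := GRing.isLinear.Build K A B _ nf_lift nf_lift_linear.
HB.instance Definition _ := GRing.isMonoidMorphism.Build A B nf_lift nf_lift_monoid_morphism.

Definition nf_lift_morphism : {lrmorphism A -> B} := nf_lift.

End Morphism.

Lemma nf_gen_presented : bq_presented (nf_bq q d) x.
Proof.
split; first exact: nf_gen_relations.
move=> B y yrel; exists (nf_lift_morphism yrel).
have liftE i : nf_lift_morphism yrel (x i) = y i.
  have -> : nf_lift_morphism yrel (x i) = nf_lift y (x i) by [].
  case: i => [[|[|[|i]]] hi] //=; rewrite /nf_gen /= nf_lift_mon ?mulr1 ?mul1r;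
    by congr (y _); apply/val_inj.
split=> // g gx u; elim/pbw_mon_ind: u => [|i j k|a u u' IHu IHu'].
- by rewrite (linear0 g) (linear0 (nf_lift_morphism yrel)).
- by rewrite -(nf_gen_mon d q0) !rmorphM !rmorphXn /= !gx -!liftE.
have linE (h : {lrmorphism A -> B}) : h (a *: u + u') = a *: h u + h u' by exact: linearP.
by rewrite !linE IHu IHu'.
Qed.

(** Ordered monomials in the generators are the monomials of the underlying polynomial space, so PBW
    coefficients are ordinary polynomial coefficients. *)
Lemma pbw_sum_coef n (u : nat -> nat -> nat -> K) i j k :
  (pbw_sum x n u : V)@_(mon3 i j k) =
  if [&& i < n, j < n & k < n]%N then u i j k else 0.
Proof.
have coefE i' j' k' : (u i' j' k' *: (x 0 ^+ i' * x 1 ^+ j' * x 2 ^+ k') : V)@_(mon3 i j k)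
    = u i' j' k' *+ (k' == k) *+ (j' == j) *+ (i' == i).
  rewrite nf_gen_mon mcoeffZ mcoeffX mulr_natr -!mulrnA !mulnb; congr (_ *+ nat_of_bool _).
  apply/eqP/andP => [/(congr1 (fun m : 'X_{1..3} => (m 0, m 1, m 2)))|].
    by rewrite !(mon3_0, mon3_1, mon3_2) => -[-> -> ->]; rewrite !eqxx.
  by case=> /eqP-> /andP[/eqP-> /eqP->].
have sumE m (F : nat -> K) i' : \sum_(i < m) F i *+ (i == i' :> nat) = F i' *+ (i' < m)%N.
  elim: m => [|m IHm]; first by rewrite big_ord0.
  rewrite big_ord_recr /= IHm ltnS [in RHS]leq_eqVlt.
  by have [->|] := eqVneq i' m; rewrite ?ltnn ?add0r ?addr0.
pose coef (p : A) : K := (p : V)@_(mon3 i j k).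
have coef_sum m (G : 'I_m -> A) : coef (\sum_(i < m) G i) = \sum_(i < m) coef (G i).
  by apply: (big_morph coef) => [p r|];
    [exact: mcoeffD|exact: mcoeff0].
rewrite -/(coef _) /pbw_sum coef_sum.
under eq_bigr => i' _.
  rewrite coef_sum.
  under eq_bigr => j' _.
    rewrite coef_sum; under eq_bigr => k' _ do rewrite /coef coefE.
    rewrite !sumrMnl sumE; over.
  rewrite sumrMnl (sumE _ (fun j' => u i' j' k *+ (k < n)%N)); over.
rewrite (sumE _ (fun i' => u i' j k *+ (k < n)%N *+ (j < n)%N)).
by case: (i < n)%N; case: (j < n)%N; case: (k < n)%N.
Qed.

Lemma nf_gen_pbw : pbw_basis x.
Proof.
split=> [p|n u p0 i j k lt_i lt_j lt_k].
  (* Each exponent is bounded by the total degree, so the cube of side [msize p] contains the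
     support. *)
  pose n := msize (p : V); exists n, (fun i j k => (p : V)@_(mon3 i j k)).
  apply/mpolyP => m; rewrite -[m in RHS]mon3E pbw_sum_coef mon3E.
  case: ifPn => // /negP nlt; apply: memN_msupp_eq0; apply/negP => /msize_mdeg_lt.
  by rewrite mdeg3 -/n => lt_n; apply: nlt; apply/and3P; split; lia.
have := pbw_sum_coef n u i j k; rewrite lt_i lt_j lt_k /= => <-.
by rewrite p0 mcoeff0.
Qed.

End NormalFormAlgebra.

(** The universal properties give [f] to the constructed algebra and [g] back, with [g (f a) = a] by
    uniqueness. Spanning is transported along [g], independence along [f]. *)
Lemma presented_nf_pbw (K : fieldType) (q : K) (d : nf_params K) (A : algType K)
    (y : 'I_3 -> A) :
  q != 0 -> bq_presented (nf_bq q d) y -> pbw_basis y.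
Proof.
move=> q0 [yrel yuniv].
have [xrel xuniv] := nf_gen_presented d q0; have [xspan xfree] := nf_gen_pbw d q0.
have [f [fy _]] := yuniv _ _ xrel; have [g [gx _]] := xuniv _ _ yrel.
have [h [_ huniq]] := yuniv _ _ yrel.
have gf a : g (f a) = a.
  transitivity (h a); last by apply/esym/(huniq (idfun : {lrmorphism A -> A})).
  by apply: (huniq (g \o f : {lrmorphism A -> A})) => i /=; rewrite fy gx.
have pbw_morph (B C : algType K) (z : 'I_3 -> B) (m : {lrmorphism B -> C}) n u :
    m (pbw_sum z n u) = pbw_sum (fun i => m (z i)) n u.
  rewrite /pbw_sum !linear_sum; apply: eq_bigr => i _; rewrite linear_sum; apply: eq_bigr => j _.
  by rewrite linear_sum; apply: eq_bigr => k _; rewrite linearZ /= !rmorphM !rmorphXn.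
split=> [a|n u sum0].
  have [n [u fa]] := xspan (f a); exists n, u.
  by rewrite -[LHS]gf fa pbw_morph /pbw_sum !gx.
apply: (xfree n u); have := congr1 f sum0.
by rewrite pbw_morph linear0 /pbw_sum !fy.
Qed.

(** * Changes of generators *)

Lemma pbw_independent (K : fieldType) (A : algType K) (x : 'I_3 -> A) (a01 a02 a12 a0 a1 a2 a : K) :
  pbw_basis x ->
  a01 *: (x 0 * x 1) + a02 *: (x 0 * x 2) + a12 *: (x 1 * x 2)
    + a0 *: x 0 + a1 *: x 1 + a2 *: x 2 + a%:A = 0 ->
  [/\ [/\ a01 = 0, a02 = 0 & a12 = 0], [/\ a0 = 0, a1 = 0 & a2 = 0] & a = 0].
Proof.
move=> [_ free] eq0.
pose u (i j k : nat) : K := match i, j, k with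
  | O, O, O => a | S O, O, O => a0 | O, S O, O => a1 | O, O, S O => a2
  | S O, S O, O => a01 | S O, O, S O => a02 | O, S O, S O => a12 | _, _, _ => 0 end.
have sum0 : pbw_sum x 2 u = 0.
  rewrite -[RHS]eq0 /pbw_sum !big_ord_recl !big_ord0 /bump /= !expr0 !expr1 !mulr1 !mul1r.
  by linear_combination K; ring.
have {}free i j k := free _ _ sum0 i j k.
split; [split|split|].
- exact: (free 1 1 0)%N.
- exact: (free 1 0 1)%N.
- exact: (free 0 1 1)%N.
- exact: (free 1 0 0)%N.
- exact: (free 0 1 0)%N.
- exact: (free 0 0 1)%N.
- exact: (free 0 0 0)%N.
Qed.

(* The equations say that the x_1 x_3, x_1 x_2 and x_2 x_3 coefficients of
   (x_3 x_2) x_1 - x_3 (x_2 x_1) vanish. *)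
Lemma quantum_overlap (K : fieldType) (A : algType K) (x : 'I_3 -> A) (P : bq_params K) (q : K) :
  q != 0 -> q != 1 -> pbw_basis x -> bq_relations P x ->
  bq_q1 P = q -> bq_q2 P = q^-1 -> bq_q3 P = q ->
  [/\ bq_nu P = bq_a P, bq_mu P = - (q * bq_alpha P) & bq_b P = - (q * bq_gamma P)].
Proof.
case: P => q1 q2 q3 a b c b1 al be ga b2 la mu nu b3 q0 q_neq1 xpbw /= [/= r1 r2 r3] e1 e2 e3.
rewrite {}e1 {}e2 {}e3 in r1 r2 r3.
move/(canRL (subrK _)): r1 => r1; move/(canRL (subrK _)): r2 => r2.
move/(canRL (subrK _)): r3 => r3.
have r210 : x 1 * (x 2 * x 0) = q^-1 *: (x 1 * x 0 * x 2) + al *: (x 1 * x 0) + be *: (x 1 * x 1)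
    + ga *: (x 1 * x 2) + b2 *: x 1.
  by rewrite r2 !mulrDr -!scalerAr mulr1 mulrA; linear_combination K; ring.
have r012 : x 2 * x 0 * x 1 = q^-1 *: (x 0 * (x 2 * x 1)) + al *: (x 0 * x 1) + be *: (x 1 * x 1)
    + ga *: (x 2 * x 1) + b2 *: x 1.
  by rewrite r2 !mulrDl -!scalerAl mul1r mulrA; linear_combination K; ring.
have left_resolution : x 2 * x 1 * x 0 = q *: (x 1 * (x 2 * x 0)) + la *: (x 0 * x 0)
    + mu *: (x 1 * x 0) + nu *: (x 2 * x 0) + b3 *: x 0.
  by rewrite r3 !mulrDl -!scalerAl mul1r mulrA; linear_combination K; ring.
have right_resolution : x 2 * (x 1 * x 0) = q *: (x 2 * x 0 * x 1) + a *: (x 2 * x 0)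
    + b *: (x 2 * x 1) + c *: (x 2 * x 2) + b1 *: x 2.
  by rewrite r1 !mulrDr -!scalerAr mulr1 mulrA; linear_combination K; ring.
rewrite r210 {1}r1 !mulrDl -!scalerAl mul1r in left_resolution.
(* The name protects the left-hand side from reassociation by [mulrA]. *)
set w := x 2 * (x 1 * x 0) in right_resolution.
rewrite r012 {1}r3 !mulrDr -!scalerAr mulr1 mulrA in right_resolution.
(* These are the coefficients of the difference of the two resolutions once ordered; the cubic
   monomial and the squares cancel. *)
have := pbw_independent (a01 := (q * al + mu) * (q - 1)) (a02 := (nu - a) * (q^-1 - 1))
  (a12 := - (b + q * ga) * (q - 1))
  (a0 := (nu - a) * al + (q * al + mu) * a - (b + q * ga) * la)
  (a1 := (nu - a) * be + (q * al + mu) * b - (b + q * ga) * mu)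
  (a2 := (nu - a) * ga + (q * al + mu) * c - (b + q * ga) * nu)
  (a := (nu - a) * b2 + (q * al + mu) * b1 - (b + q * ga) * b3) xpbw.
case.
  transitivity (x 2 * x 1 * x 0 - x 2 * (x 1 * x 0)); last by rewrite mulrA subrr.
  rewrite -/w left_resolution right_resolution !r1 !r2 !r3.
  by linear_combination K; field.
have qB1 : q - 1 != 0 by rewrite subr_eq0.
have qVB1 : q^-1 - 1 != 0 by rewrite subr_eq0 -[1]invr1 (inj_eq invr_inj).
move=> [/eqP]; rewrite mulf_eq0 (negPf qB1) orbF => /eqP e1 /eqP.
rewrite mulf_eq0 (negPf qVB1) orbF => /eqP e2 /eqP.
rewrite mulf_eq0 (negPf qB1) orbF => /eqP e3 _ _.
split; first exact: subr0_eq e2.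
  by apply/eqP; rewrite -addr_eq0 addrC e1.
by apply/eqP; rewrite -addr_eq0 -oppr_eq0 e3.
Qed.

(** A permutation followed by an affine change; every product of generators of the group can be
    brought to this form. *)
Definition gen_change (K : fieldType) (l m : 'I_3 -> K) (s : 'S_3) (A : algType K)
  (x : 'I_3 -> A) : 'I_3 -> A := fun i => l i *: x (s i) + (m i)%:A.

Lemma bq_relations_ext (K : fieldType) (P : bq_params K) (A : algType K) (x y : 'I_3 -> A) :
  x =1 y -> bq_relations P x -> bq_relations P y.
Proof. by move=> xy; rewrite /bq_relations !xy. Qed.

Lemma gen_change_ext (K : fieldType) (l m : 'I_3 -> K) s (A : algType K) (x y : 'I_3 -> A) :
  x =1 y -> gen_change l m s x =1 gen_change l m s y.
Proof. by move=> xy i; rewrite /gen_change xy. Qed.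

Lemma gen_change_morph (K : fieldType) (l m : 'I_3 -> K) s (A B : algType K)
    (f : {lrmorphism A -> B}) (x : 'I_3 -> A) :
  (f \o gen_change l m s x) =1 gen_change l m s (f \o x).
Proof. by move=> i; rewrite /gen_change /= linearD !linearZ /= rmorph1. Qed.

(** Mutually inverse substitutions that exchange the two sets of relations in every algebra identify
    the two universal problems. *)
Lemma presented_gen_change (K : fieldType) (P P' : bq_params K) (l m l' m' : 'I_3 -> K) (s s' : 'S_3)
    (A : algType K) (x y : 'I_3 -> A) :
  (forall (B : algType K) (z : 'I_3 -> B), bq_relations P z -> bq_relations P' (gen_change l m s z)) ->
  (forall (B : algType K) (z : 'I_3 -> B), bq_relations P' z -> bq_relations P (gen_change l' m' s' z)) ->
  (forall (B : algType K) (z : 'I_3 -> B),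
    gen_change l' m' s' (gen_change l m s z) =1 z /\
    gen_change l m s (gen_change l' m' s' z) =1 z) ->
  y =1 gen_change l m s x ->
  bq_presented P x -> bq_presented P' y.
Proof.
move=> relPP' relP'P changeK yE [xrel xuniv]; split.
  by apply: (bq_relations_ext (fsym yE)); apply: relPP'.
move=> B z zrel; have [f [fx funiq]] := xuniv _ _ (relP'P _ _ zrel); exists f; split.
  move=> i; rewrite yE -[f _]/((f \o _) i) gen_change_morph -[RHS](proj2 (changeK _ z)).
  exact: gen_change_ext.
move=> g gy; apply: funiq => i.
rewrite -(proj1 (changeK _ x) i) -[g _]/((g \o _) i) gen_change_morph.
by apply: gen_change_ext => j /=; rewrite -yE gy.
Qed.

Lemma presented_ext (K : fieldType) (P : bq_params K) (A : algType K) (x y : 'I_3 -> A) :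
  x =1 y -> bq_presented P x -> bq_presented P y.
Proof.
move=> xy [xrel xuniv]; split; first exact: bq_relations_ext xrel.
move=> B z zrel; have [f [fx funiq]] := xuniv _ _ zrel; exists f; split.
  by move=> i; rewrite -xy.
by move=> g gy; apply: funiq => i; rewrite xy.
Qed.

Lemma ord3_ind (P : 'I_3 -> Prop) : P 0 -> P 1 -> P 2 -> forall i, P i.
Proof.
by move=> P0 P1 P2 [[|[|[|i]]] hi] //; [move: P0|move: P1|move: P2]; congr P; apply/val_inj.
Qed.

Lemma G3_change_gen_change (K : fieldType) (A : algType K) (x y : 'I_3 -> A) :
  G3_change x y ->
  exists (l m : 'I_3 -> K) (s : 'S_3), (forall i, l i != 0) /\ y =1 gen_change l m s x.
Proof.
elim=> [|{}y z _ [l [m [s [l0 yE]]]] [l' [m' [l'0 zE]]]|{}y z _ [l [m [s [l0 yE]]]] [t zE]].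
- exists (fun=> 1), (fun=> 0), 1%g; split=> [i|i]; first exact: oner_neq0.
  by rewrite /gen_change perm1; linear_combination K; ring.
- exists (fun i => l' i * l i), (fun i => l' i * m i + m' i), s.
  split=> i; first by rewrite mulf_neq0.
  by rewrite zE yE /gen_change; linear_combination K; ring.
- exists (l \o t), (m \o t), (t * s)%g; split=> i /=; first exact: l0.
  by rewrite zE yE /gen_change /= permM.
Qed.

(** * Effect of rescalings, transpositions and shifts on normal forms *)

Section Moves.

Variable K : fieldType.
Implicit Types (q : K) (d : nf_params K) (l : 'I_3 -> K).

Definition nf_scale l d : nf_params K :=
  {| nf_c := l 0 * l 1 / l 2 * nf_c d; nf_beta := l 0 * l 2 / l 1 * nf_beta d;
     nf_lambda := l 1 * l 2 / l 0 * nf_lambda d;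
     nf_b1 := l 0 * l 1 * nf_b1 d; nf_b2 := l 0 * l 2 * nf_b2 d; nf_b3 := l 1 * l 2 * nf_b3 d |}.

(** Exchanging [x_1] and [x_2] means solving the first relation for [x_1 x_2], whence the factor
    [- q^-1]; the other two relations trade places and [q] becomes [q^-1]. *)
Definition nf_swap01 q d : nf_params K :=
  {| nf_c := - (q^-1 * nf_c d); nf_beta := nf_lambda d; nf_lambda := nf_beta d;
     nf_b1 := - (q^-1 * nf_b1 d); nf_b2 := nf_b3 d; nf_b3 := nf_b2 d |}.

Definition nf_swap12 q d : nf_params K :=
  {| nf_c := nf_beta d; nf_beta := nf_c d; nf_lambda := - (q^-1 * nf_lambda d);
     nf_b1 := nf_b2 d; nf_b2 := nf_b1 d; nf_b3 := - (q^-1 * nf_b3 d) |}.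

Lemma nf_relations_scale q d l (A : algType K) (x : 'I_3 -> A) :
  q != 0 -> (forall i, l i != 0) -> bq_relations (nf_bq q d) x ->
  bq_relations (nf_bq q (nf_scale l d)) (gen_change l (fun=> 0) 1 x).
Proof.
move=> q0 l0 [/= r1 r2 r3]; move/(canRL (subrK _)): r1 => r1.
move/(canRL (subrK _)): r2 => r2; move/(canRL (subrK _)): r3 => r3.
have := l0 0; have := l0 1; have := l0 2; rewrite /bq_relations /gen_change /= !perm1.
move: (l 0) (l 1) (l 2) => l_0 l_1 l_2 l20 l10 l00.
split; rewrite !scale0r !addr0 -!scalerAl -!scalerAr ?r1 ?r2 ?r3.
- by linear_combination K; field.
- by linear_combination K; field; rewrite ?q0 ?l00 ?l10 ?l20.
- by linear_combination K; field; rewrite ?q0 ?l00 ?l10 ?l20.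
Qed.

Lemma nf_relations_swap01 q d (A : algType K) (x : 'I_3 -> A) :
  q != 0 -> bq_relations (nf_bq q d) x ->
  bq_relations (nf_bq q^-1 (nf_swap01 q d)) (gen_change (fun=> 1) (fun=> 0) (tperm 0 1) x).
Proof.
move=> q0 [/= r1 r2 r3]; move/(canRL (subrK _)): r1 => r1.
move/(canRL (subrK _)): r2 => r2; move/(canRL (subrK _)): r3 => r3.
rewrite /bq_relations /gen_change /= tpermL tpermR tpermD //.
split; rewrite !scale0r !scale1r !addr0 ?r1 ?r2 ?r3 ?invrK.
- by linear_combination K; field.
- by linear_combination K; field.
- by linear_combination K; field.
Qed.

Lemma nf_relations_swap12 q d (A : algType K) (x : 'I_3 -> A) :
  q != 0 -> bq_relations (nf_bq q d) x ->
  bq_relations (nf_bq q^-1 (nf_swap12 q d)) (gen_change (fun=> 1) (fun=> 0) (tperm 1 2) x).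
Proof.
move=> q0 [/= r1 r2 r3]; move/(canRL (subrK _)): r1 => r1.
move/(canRL (subrK _)): r2 => r2; move/(canRL (subrK _)): r3 => r3.
rewrite /bq_relations /gen_change /= tpermL tpermR tpermD //.
split; rewrite !scale0r !scale1r !addr0 ?r1 ?r2 ?r3 ?invrK.
- by linear_combination K; field.
- by linear_combination K; field.
- by linear_combination K; field.
Qed.

Lemma nf_scaleK l d : (forall i, l i != 0) -> nf_scale (fun i => (l i)^-1) (nf_scale l d) = d.
Proof.
move=> l0; have := l0 0; have := l0 1; have := l0 2; case: d => c be la b1 b2 b3.
rewrite /nf_scale /=; move: (l 0) (l 1) (l 2) => l_0 l_1 l_2 l20 l10 l00.
by congr NfParams; field; rewrite ?l20 ?l10 ?l00 ?oner_neq0.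
Qed.

Lemma nf_swap01K q d : q != 0 -> nf_swap01 q^-1 (nf_swap01 q d) = d.
Proof. by case: d => c be la b1 b2 b3 q0; rewrite /nf_swap01 /=; congr NfParams; rewrite ?invrK; field. Qed.

Lemma nf_swap12K q d : q != 0 -> nf_swap12 q^-1 (nf_swap12 q d) = d.
Proof. by case: d => c be la b1 b2 b3 q0; rewrite /nf_swap12 /=; congr NfParams; rewrite ?invrK; field. Qed.

Lemma nf_presented_scale q d l (A : algType K) (x : 'I_3 -> A) :
  q != 0 -> (forall i, l i != 0) -> bq_presented (nf_bq q d) x ->
  bq_presented (nf_bq q (nf_scale l d)) (fun i => l i *: x i).
Proof.
move=> q0 l0; have lV0 i : (l i)^-1 != 0 by rewrite invr_neq0.
apply: (@presented_gen_change _ _ _ l (fun=> 0) (fun i => (l i)^-1) (fun=> 0) 1%g 1%g).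
- by move=> B z; apply: nf_relations_scale.
- by move=> B z /(nf_relations_scale q0 lV0); rewrite nf_scaleK.
- by move=> B z; split=> i; rewrite /gen_change !perm1; linear_combination K; field; exact: l0.
- by move=> i; rewrite /gen_change perm1 scale0r addr0.
Qed.

Lemma gen_change_tpermK (i j : 'I_3) (A : algType K) (x : 'I_3 -> A) :
  gen_change (fun=> 1) (fun=> 0) (tperm i j) (gen_change (fun=> 1) (fun=> 0) (tperm i j) x) =1 x.
Proof. by move=> k; rewrite /gen_change tpermK; linear_combination K; ring. Qed.

Lemma gen_change_tperm (i j : 'I_3) (A : algType K) (x : 'I_3 -> A) :
  x \o tperm i j =1 gen_change (fun=> 1) (fun=> 0) (tperm i j) x.
Proof. by move=> k; rewrite /gen_change /=; linear_combination K; ring. Qed.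

Lemma nf_presented_swap01 q d (A : algType K) (x : 'I_3 -> A) :
  q != 0 -> bq_presented (nf_bq q d) x ->
  bq_presented (nf_bq q^-1 (nf_swap01 q d)) (x \o tperm 0 1).
Proof.
move=> q0; apply: presented_gen_change.
- by move=> B z; apply: nf_relations_swap01.
- by move=> B z /(nf_relations_swap01 (invr_neq0 q0)); rewrite invrK nf_swap01K // => h; exact: h.
- by move=> B z; split; apply: gen_change_tpermK.
- exact: gen_change_tperm.
Qed.

Lemma nf_presented_swap12 q d (A : algType K) (x : 'I_3 -> A) :
  q != 0 -> bq_presented (nf_bq q d) x ->
  bq_presented (nf_bq q^-1 (nf_swap12 q d)) (x \o tperm 1 2).
Proof.
move=> q0; apply: presented_gen_change.
- by move=> B z; apply: nf_relations_swap12.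
- by move=> B z /(nf_relations_swap12 (invr_neq0 q0)); rewrite invrK nf_swap12K // => h; exact: h.
- by move=> B z; split; apply: gen_change_tpermK.
- exact: gen_change_tperm.
Qed.

(* Each shift has to satisfy two conditions; the overlap relations make them agree. *)
Lemma quantum_normal_form q (A : algType K) (x : 'I_3 -> A) :
  q != 0 -> quantum_biquadratic q x ->
  exists m d, bq_presented (nf_bq q d) (fun i => x i + (m i)%:A).
Proof.
move=> q0 [q_neq1 [P [[_ xpres xpbw] e1 e2 e3]]].
have {}e2 : bq_q2 P = q^-1 by rewrite -e2 invrK.
have [enu emu eb] := quantum_overlap q0 q_neq1 xpbw xpres.1 e1 e2 e3.
case: P e1 e2 e3 enu emu eb xpres => q1 q2 q3 a b c b1 al be ga b2 la mu nu b3 /=.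
move=> -> -> -> -> -> -> xpres {xpbw q1 q2 q3 b mu nu}.
have q1B : 1 - q != 0 by rewrite subr_eq0 eq_sym.
(* The shifts are determined by killing [a], [gamma] and [alpha]; the overlap relations then kill
   [nu], [b] and [mu]. *)
have [m [aE gaE alE]] : exists m : 'I_3 -> K,
    [/\ a = - ((1 - q) * m 1), ga = q^-1 * (1 - q) * m 0 & al = q^-1 * (1 - q) * m 2].
  exists (fun i => match val i with O => q * ga / (1 - q) | S O => - a / (1 - q)
                | _ => q * al / (1 - q) end).
  by split=> /=; field; rewrite ?q1B ?q0.
pose d := {| nf_c := c; nf_beta := be; nf_lambda := la;
  nf_b1 := b1 - c * m 2 + (1 - q) * m 0 * m 1;
  nf_b2 := b2 - be * m 1 + (1 - q^-1) * m 0 * m 2;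
  nf_b3 := b3 - la * m 0 + (1 - q) * m 1 * m 2 |}.
exists m, d; move: xpres; rewrite {}aE {}gaE {}alE.
apply: (@presented_gen_change _ _ _ (fun=> 1) m (fun=> 1) (fun i => - m i) 1%g 1%g).
- move=> B z [/= r1 r2 r3]; move/(canRL (subrK _)): r1 => r1.
  move/(canRL (subrK _)): r2 => r2; move/(canRL (subrK _)): r3 => r3.
  rewrite /bq_relations /gen_change /= !perm1 !scale1r.
  split; rewrite !mulrDl !mulrDr -?scalerAl -?scalerAr ?mulr1 ?mul1r ?r1 ?r2 ?r3.
  + by linear_combination K; field.
  + by linear_combination K; field.
  + by linear_combination K; field.
- move=> B z [/= r1 r2 r3]; move/(canRL (subrK _)): r1 => r1.
  move/(canRL (subrK _)): r2 => r2; move/(canRL (subrK _)): r3 => r3.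
  rewrite /bq_relations /gen_change /= !perm1 !scale1r.
  split; rewrite !mulrDl !mulrDr -?scalerAl -?scalerAr ?mulr1 ?mul1r ?r1 ?r2 ?r3.
  + by linear_combination K; field.
  + by linear_combination K; field.
  + by linear_combination K; field.
- by move=> B z; split=> i; rewrite /gen_change !perm1; linear_combination K; ring.
- by move=> i; rewrite /gen_change perm1 scale1r.
Qed.

(** Writing the relations of [y] in the PBW basis of [x], the coefficient of [x 0 * x 1] gives
    [q = q'], and linear coefficients [l i * m j * (1 - q)] force all shifts to vanish. What remains
    is a rescaling. *)
Lemma nf_rigid q q' d d' l m (A : algType K) (x y : 'I_3 -> A) :
  q' != 1 -> pbw_basis x -> bq_relations (nf_bq q' d') x -> bq_relations (nf_bq q d) y ->
  (forall i, l i != 0) -> (forall i, y i = l i *: x i + (m i)%:A) ->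
  q = q' /\ d = nf_scale l d'.
Proof.
move=> q'_neq1 xpbw [/= r1 r2 r3] [/= s1 s2 s3] l0 yE.
move/(canRL (subrK _)): r1 => r1; move/(canRL (subrK _)): r2 => r2.
move/(canRL (subrK _)): r3 => r3.
have /(pbw_independent xpbw)[[e01 _ _] [em1 em0 ec] eb1] :
    (l 0 * l 1 * (q' - q)) *: (x 0 * x 1) + 0 *: (x 0 * x 2) + 0 *: (x 1 * x 2)
    + (l 0 * m 1 * (1 - q)) *: x 0 + (l 1 * m 0 * (1 - q)) *: x 1
    + (l 0 * l 1 * nf_c d' - nf_c d * l 2) *: x 2
    + (l 0 * l 1 * nf_b1 d' + (1 - q) * m 0 * m 1 - nf_c d * m 2 - nf_b1 d)%:A = 0.
  transitivity ((y 1 * y 0 - q *: (y 0 * y 1))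
    - (0 *: y 0 + 0 *: y 1 + nf_c d *: y 2 + (nf_b1 d)%:A)); last by rewrite s1 subrr.
  rewrite !yE !mulrDl !mulrDr -?scalerAl -?scalerAr ?mulr1 ?mul1r r1.
  by linear_combination K; ring.
have /(pbw_independent xpbw)[_ [_ ebeta _] eb2] :
    0 *: (x 0 * x 1) + (l 0 * l 2 * (q'^-1 - q^-1)) *: (x 0 * x 2) + 0 *: (x 1 * x 2)
    + (l 0 * m 2 * (1 - q^-1)) *: x 0 + (l 0 * l 2 * nf_beta d' - nf_beta d * l 1) *: x 1
    + (l 2 * m 0 * (1 - q^-1)) *: x 2
    + (l 0 * l 2 * nf_b2 d' + (1 - q^-1) * m 0 * m 2 - nf_beta d * m 1 - nf_b2 d)%:A = 0.
  transitivity ((y 2 * y 0 - q^-1 *: (y 0 * y 2))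
    - (0 *: y 0 + nf_beta d *: y 1 + 0 *: y 2 + (nf_b2 d)%:A)); last by rewrite s2 subrr.
  rewrite !yE !mulrDl !mulrDr -?scalerAl -?scalerAr ?mulr1 ?mul1r r2.
  by linear_combination K; ring.
have /(pbw_independent xpbw)[_ [elambda em2 _] eb3] :
    0 *: (x 0 * x 1) + 0 *: (x 0 * x 2) + (l 1 * l 2 * (q' - q)) *: (x 1 * x 2)
    + (l 1 * l 2 * nf_lambda d' - nf_lambda d * l 0) *: x 0
    + (l 1 * m 2 * (1 - q)) *: x 1 + (l 2 * m 1 * (1 - q)) *: x 2
    + (l 1 * l 2 * nf_b3 d' + (1 - q) * m 1 * m 2 - nf_lambda d * m 0 - nf_b3 d)%:A = 0.
  transitivity ((y 2 * y 1 - q *: (y 1 * y 2))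
    - (nf_lambda d *: y 0 + 0 *: y 1 + 0 *: y 2 + (nf_b3 d)%:A)); last by rewrite s3 subrr.
  rewrite !yE !mulrDl !mulrDr -?scalerAl -?scalerAr ?mulr1 ?mul1r r3.
  by linear_combination K; ring.
have qq' : q = q'.
  by move/eqP: e01; rewrite !mulf_eq0 !(negPf (l0 _)) /= subr_eq0 => /eqP.
have qB1 : 1 - q != 0 by rewrite subr_eq0 eq_sym qq'.
have kill i j : l i * m j * (1 - q) = 0 -> m j = 0.
  by move/eqP; rewrite !mulf_eq0 (negPf (l0 _)) (negPf qB1) orbF /= => /eqP.
have [{}em0 {}em1 {}em2] : [/\ m 0 = 0, m 1 = 0 & m 2 = 0] by split; apply: kill; eassumption.
split=> //; move: ec ebeta elambda eb1 eb2 eb3; rewrite em0 em1 em2 !mulr0 !subr0 !addr0.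
move=> /subr0_eq ec /subr0_eq ebeta /subr0_eq elambda /subr0_eq eb1 /subr0_eq eb2 /subr0_eq eb3.
case: d s1 s2 s3 ec ebeta elambda eb1 eb2 eb3 => c be la b1 b2 b3 /= _ _ _ ec ebeta elambda <- <- <-.
rewrite /nf_scale; congr NfParams.
- by rewrite mulrAC ec mulfK.
- by rewrite mulrAC ebeta mulfK.
- by rewrite mulrAC elambda mulfK.
Qed.

End Moves.

(** * Classification of the parameters *)

Ltac nonzero := repeat first
  [done | apply/andP; split | apply: mulf_neq0 | apply: invr_neq0 | apply: expf_neq0].

Section Classification.

Variable K : fieldType.
Implicit Types (q : K) (d : nf_params K) (l : 'I_3 -> K).

(* Sorting the pairs (c, b1), (beta, b2), (lambda, b3) by this rank puts a normal form
   into one of the ten shapes of the theorem. *)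
Definition pair_rank (c b : K) : nat := if c != 0 then 2%N else (b != 0).

Definition rank1 d := pair_rank (nf_c d) (nf_b1 d).
Definition rank2 d := pair_rank (nf_beta d) (nf_b2 d).
Definition rank3 d := pair_rank (nf_lambda d) (nf_b3 d).

Definition rank_count (r : nat) d : nat :=
  ((rank1 d == r) + (rank2 d == r) + (rank3 d == r))%N.

Lemma pair_rank_scale (u v c b : K) :
  u != 0 -> v != 0 -> pair_rank (u * c) (v * b) = pair_rank c b.
Proof. by move=> u0 v0; rewrite /pair_rank !mulf_eq0 (negPf u0) (negPf v0). Qed.

Lemma pair_rankN (c b : K) : pair_rank (- c) (- b) = pair_rank c b.
Proof. by rewrite /pair_rank !oppr_eq0. Qed.

Lemma rank_scale l d : (forall i, l i != 0) ->
  [/\ rank1 (nf_scale l d) = rank1 d, rank2 (nf_scale l d) = rank2 d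
    & rank3 (nf_scale l d) = rank3 d].
Proof.
by move=> l0; split; apply: pair_rank_scale; rewrite ?mulf_neq0 ?invr_neq0.
Qed.

Lemma rank_swap01 q d : q != 0 ->
  [/\ rank1 (nf_swap01 q d) = rank1 d, rank2 (nf_swap01 q d) = rank3 d
    & rank3 (nf_swap01 q d) = rank2 d].
Proof.
by move=> q0; split=> //; rewrite /rank1 pair_rankN pair_rank_scale ?invr_neq0.
Qed.

Lemma rank_swap12 q d : q != 0 ->
  [/\ rank1 (nf_swap12 q d) = rank2 d, rank2 (nf_swap12 q d) = rank1 d
    & rank3 (nf_swap12 q d) = rank3 d].
Proof.
by move=> q0; split=> //; rewrite /rank3 pair_rankN pair_rank_scale ?invr_neq0.
Qed.

Lemma rank_count_scale l d r : (forall i, l i != 0) ->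
  rank_count r (nf_scale l d) = rank_count r d.
Proof. by move=> /(rank_scale d)[e1 e2 e3]; rewrite /rank_count e1 e2 e3. Qed.

Lemma rank_count_swap01 q d r : q != 0 -> rank_count r (nf_swap01 q d) = rank_count r d.
Proof.
by move=> /(rank_swap01 d)[e1 e2 e3]; rewrite /rank_count e1 e2 e3 addnAC.
Qed.

Lemma rank_count_swap12 q d r : q != 0 -> rank_count r (nf_swap12 q d) = rank_count r d.
Proof.
by move=> /(rank_swap12 d)[e1 e2 e3]; rewrite /rank_count e1 e2 e3 (addnC (_ == r)).
Qed.

(** Bubble sort: [nf_swap01] exchanges the last two ranks, [nf_swap12] the first two. [S] carries
    along whatever has to be remembered about the normal form. *)
Lemma rank_sort (S : K -> nf_params K -> Prop) q d :
  q != 0 -> S q d ->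
  (forall q d, q != 0 -> S q d -> S q^-1 (nf_swap01 q d)) ->
  (forall q d, q != 0 -> S q d -> S q^-1 (nf_swap12 q d)) ->
  exists q' d', [/\ q' != 0, S q' d', (rank2 d' <= rank1 d')%N & (rank3 d' <= rank2 d')%N].
Proof.
move=> q0 Sqd Sswap01 Sswap12.
have {q d q0 Sqd} [q [d [q0 Sqd le32]]] : exists q d, [/\ q != 0, S q d & (rank3 d <= rank2 d)%N].
  have [le|/ltnW le] := leqP (rank3 d) (rank2 d); first by exists q, d.
  have [_ e2 e3] := rank_swap01 d q0.
  by exists q^-1, (nf_swap01 q d); rewrite e2 e3 invr_neq0 //; split=> //; apply: Sswap01.
have {q d q0 Sqd le32} [q [d [q0 Sqd le21 le31]]] :
    exists q d, [/\ q != 0, S q d, (rank2 d <= rank1 d)%N & (rank3 d <= rank1 d)%N].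
  have [le|/ltnW le] := leqP (rank2 d) (rank1 d).
    by exists q, d; split=> //; apply: leq_trans le.
  have [e1 e2 e3] := rank_swap12 d q0.
  by exists q^-1, (nf_swap12 q d); rewrite e1 e2 e3 invr_neq0 //; split=> //; apply: Sswap12.
have [le|/ltnW le] := leqP (rank3 d) (rank2 d); first by exists q, d.
have [e1 e2 e3] := rank_swap01 d q0.
by exists q^-1, (nf_swap01 q d); rewrite e1 e2 e3 invr_neq0 //; split=> //; apply: Sswap01.
Qed.

(** The existence half of [power_class_reps], for one exponent; it also covers the set [{1}] when
    roots of that order exist. *)
Definition has_power_reps (T : nat -> K -> Prop) (n : nat) :=
  forall mu : K, mu != 0 -> exists t xi, [/\ T n t, xi != 0 & t = mu * xi ^+ n].

Definition vec3 (a0 a1 a2 : K) (i : 'I_3) : K :=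
  match val i with O => a0 | S O => a1 | _ => a2 end.

Lemma vec3_neq0 (a0 a1 a2 : K) :
  a0 != 0 -> a1 != 0 -> a2 != 0 -> forall i, vec3 a0 a1 a2 i != 0.
Proof. by move=> h0 h1 h2; apply: ord3_ind. Qed.

Lemma pair_rankP (c b : K) :
  [\/ c != 0 /\ pair_rank c b = 2%N, [/\ c = 0, b != 0 & pair_rank c b = 1%N]
    | [/\ c = 0, b = 0 & pair_rank c b = 0%N]].
Proof.
rewrite /pair_rank; have [->|] := eqVneq c 0; last by constructor 1.
by have [->|] := eqVneq b 0; [constructor 3|constructor 2].
Qed.

Lemma sorted_in_case T d :
  has_power_reps T 2 -> has_power_reps T 3 -> has_power_reps T 4 ->
  (rank2 d <= rank1 d)%N -> (rank3 d <= rank2 d)%N ->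
  exists k l, (forall i, l i != 0) /\ in_case T k (nf_scale l d).
Proof.
move=> T2 T3 T4; case: d => c be la b1 b2 b3; rewrite /rank1 /rank2 /rank3 /=.
have n1 : 1 != 0 :> K by exact: oner_neq0.
(* Of the 27 combinations of ranks, ten are sorted. *)
have [[c0 ->]|[-> b10 ->]|[-> -> ->]] := pair_rankP c b1;
have [[be0 ->]|[-> b20 ->]|[-> -> ->]] := pair_rankP be b2 => //;
have [[la0 ->]|[-> b30 ->]|[-> -> ->]] := pair_rankP la b3 => //= _ _.
(* [c] becomes 1 for [l 2 = l 0 * l 1 * c]; then [be] and [la] become [(l 0)^2 * c * be] and
   [(l 1)^2 * c * la]. *)
- have [|t [u [Tt u0 tE]]] := T2 (c * be); first by nonzero.
  have [|t' [u' [Tt' u'0 t'E]]] := T2 (c * la); first by nonzero.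
  exists Case1, (vec3 u u' (u * u' * c)); split; first by apply: vec3_neq0; nonzero.
  exists t, t'; split=> //; rewrite /= tE t'E /vec3 /=.
  by congr (_, _, _); field; nonzero.
(* With [l 1 = u^-1], making [b3] and [c] equal to 1 determines [l 2] and [l 0], and [be] becomes
   [u^4 * be / (c * b3^2)]. *)
- have [|t [u [Tt u0 tE]]] := T4 (be / (c * b3 ^+ 2)); first by nonzero.
  exists Case2, (vec3 (u ^+ 2 / (c * b3)) u^-1 (u / b3)).
  split; first by apply: vec3_neq0; nonzero.
  split; first by rewrite /= mulr0.
  left; exists t; split=> //; rewrite /= tE /vec3 /=.
  by congr (_, _, _); field; nonzero.
- have [|t [u [Tt u0 tE]]] := T2 (c * be); first by nonzero.
  exists Case2, (vec3 u 1 (u * c)); split; first by apply: vec3_neq0; nonzero.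
  split; first by rewrite /= mulr0.
  right; exists t; split=> //; rewrite /= tE /vec3 /=.
  by congr (_, _, _); field; nonzero.
(* With [l 0 = u^-1], making [b2] and [c] equal to 1 determines [l 2] and [l 1], and [b3] becomes
   [u^3 * b3 / (c * b2^2)]. *)
- have [|t [u [Tt u0 tE]]] := T3 (b3 / (c * b2 ^+ 2)); first by nonzero.
  exists Case3, (vec3 u^-1 (u ^+ 2 / (c * b2)) (u / b2)).
  split; first by apply: vec3_neq0; nonzero.
  split; rewrite /= ?mulr0 //.
  left; exists t; split=> //; rewrite /= tE /vec3 /=.
  by congr (_, _, _); field; nonzero.
- exists Case3, (vec3 1 (c * b2)^-1 b2^-1).
  split; first by apply: vec3_neq0; nonzero.
  split; rewrite /= ?mulr0 //.
  right; left; rewrite /vec3 /=.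
  by congr (_, _, _); field; nonzero.
- exists Case3, (vec3 1 1 c).
  split; first by apply: vec3_neq0.
  split; rewrite /= ?mulr0 //.
  right; right; rewrite /vec3 /=.
  by congr (_, _, _); field; nonzero.
(* With [l 0 = u^-1], making [b1] and [b2] equal to 1 determines [l 1] and [l 2], and [b3] becomes
   [u^2 * b3 / (b1 * b2)]. *)
- have [|t [u [Tt u0 tE]]] := T2 (b3 / (b1 * b2)); first by nonzero.
  exists Case4, (vec3 u^-1 (u / b1) (u / b2)).
  split; first by apply: vec3_neq0; nonzero.
  split; rewrite /= ?mulr0 //.
  left; exists t; split=> //; rewrite /= tE /vec3 /=.
  by congr (_, _, _); field; nonzero.
- exists Case4, (vec3 1 b1^-1 b2^-1).
  split; first by apply: vec3_neq0; nonzero.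
  split; rewrite /= ?mulr0 //.
  right; left; rewrite /vec3 /=.
  by congr (_, _, _); field; nonzero.
- exists Case4, (vec3 1 b1^-1 1).
  split; first by apply: vec3_neq0; nonzero.
  split; rewrite /= ?mulr0 //.
  right; right; left; rewrite /vec3 /=.
  by congr (_, _, _); field; nonzero.
- exists Case4, (vec3 1 1 1).
  split; first by apply: vec3_neq0.
  split; rewrite /= ?mulr0 //.
  by right; right; right.
Qed.

Definition case_rank (k : nf_case) : nat :=
  match k with Case1 => 3 | Case2 => 2 | Case3 => 1 | Case4 => 0 end.

Lemma in_case_rank T k d :
  (forall n t, (2 <= n)%N -> T n t -> t != 0) ->
  in_case T k d -> rank_count 2 d = case_rank k.
Proof.
move=> T0; case: d => c be la b1 b2 b3; rewrite /rank_count /rank1 /rank2 /rank3 /pair_rank.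
case: k => /=.
- by move=> [mu [nu [/T0 mu0 /T0 nu0 [-> -> ->]]]]; rewrite oner_neq0 mu0 ?nu0.
- move=> [-> [[mu [/T0 mu0 [-> -> ->]]]|[mu [/T0 mu0 [-> -> ->]]]]];
  by rewrite !eqxx ?oner_neq0 mu0.
- by move=> [-> -> [[mu [/T0 mu0 [-> -> ->]]]|[[-> -> ->]|[-> -> ->]]]]; rewrite !eqxx ?oner_neq0 ?mu0.
- by move=> [-> -> -> [[mu [/T0 mu0 [-> -> ->]]]|[[-> -> ->]|[[-> -> ->]|[-> -> ->]]]]];
    rewrite !eqxx ?oner_neq0 ?mu0.
Qed.

(** The numbers of pairs of rank 2 and of rank 1; they differ for any two of the ten types. *)
Definition type_rank (t : nf_type) : nat * nat :=
  match t with
  | Type1 => (3, 0) | Type2_b3_0 => (2, 0) | Type2_b3_1 => (2, 1)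
  | Type3_11 => (1, 2) | Type3_10 => (1, 1) | Type3_00 => (1, 0)
  | Type4_111 => (0, 3) | Type4_110 => (0, 2) | Type4_100 => (0, 1) | Type4_000 => (0, 0)
  end%N.

Lemma in_type_rank t d : in_type t d -> (rank_count 2 d, rank_count 1 d) = type_rank t.
Proof.
case: d => c be la b1 b2 b3; rewrite /rank_count /rank1 /rank2 /rank3 /pair_rank.
by case: t => /=; [move=> [-> -> ->]|move=> [[-> -> ->] ->]|move=> [[-> -> ->] ->]
  |move=> [[-> -> ->] [-> ->]]|move=> [[-> -> ->] [-> ->]]|move=> [[-> -> ->] [-> ->]]
  |move=> [[-> -> ->] [-> -> ->]]|move=> [[-> -> ->] [-> -> ->]]|move=> [[-> -> ->] [-> -> ->]]
  |move=> [[-> -> ->] [-> -> ->]]]; rewrite ?(eqxx, oner_eq0).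
Qed.

Lemma in_case_type k d :
  in_case (fun _ t => t = 1) k d -> exists t, in_type t d.
Proof.
case: d => c be la b1 b2 b3; case: k => /=.
- by move=> [mu [nu [-> -> [-> -> ->]]]]; exists Type1.
- by move=> [-> [[mu [-> [-> -> ->]]]|[mu [-> [-> -> ->]]]]]; [exists Type2_b3_1|exists Type2_b3_0].
- by move=> [-> -> [[mu [-> [-> -> ->]]]|[[-> -> ->]|[-> -> ->]]]];
    [exists Type3_11|exists Type3_10|exists Type3_00].
- by move=> [-> -> -> [[mu [-> [-> -> ->]]]|[[-> -> ->]|[[-> -> ->]|[-> -> ->]]]]];
    [exists Type4_111|exists Type4_110|exists Type4_100|exists Type4_000].
Qed.

End Classification.

(** Reduces permutations to words in the two transpositions whose effect on normal forms is
    known. *)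
Lemma S3_ind (P : 'S_3 -> Prop) (t01 := tperm 0 1 : 'S_3) (t12 := tperm 1 2 : 'S_3) :
  P 1%g -> (forall s, P s -> P (t01 * s)%g) -> (forall s, P s -> P (t12 * s)%g) ->
  forall s, P s.
Proof.
move=> P1 P01 P12 s; have [ts -> _] := prod_tpermP s.
elim: ts => [|[i j] ts IH]; first by rewrite big_nil.
rewrite big_cons /=; move: (\prod_(_ <- _) _)%g IH => {s ts}t Pt.
(* The transposition of 0 and 2 is a conjugate of one adjacent transposition by the other. *)
have P02 : P (tperm 0%R 2%R * t)%g.
  have -> : tperm 0 2 = (t01 * t12 * t01)%g :> 'S_3.
    by rewrite -{1}[t01]tpermV -mulgA -conjgE tpermJ tpermR tpermD.
  by rewrite -!mulgA; apply/P01/P12/P01.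
by elim/ord3_ind: i; elim/ord3_ind: j; rewrite ?tperm1 ?mul1g //;
  first [exact: P01|exact: P12|exact: P02|rewrite tpermC; first [exact: P01|exact: P12|exact: P02]].
Qed.

(** * Existence and invariants of normal forms of a quantum algebra *)

Section QuantumAlgebra.

Variables (K : fieldType) (A : algType K) (x : 'I_3 -> A) (q1 : K).
Hypothesis xq : quantum_biquadratic q1 x.

Lemma quantum_param_neq0 : q1 != 0.
Proof. by have [_ [P [[[P0 _ _] _ _] <- _ _]]] := xq. Qed.

Let q1_neq0 := quantum_param_neq0.

Lemma nf_exists (T : nat -> K -> Prop) :
  has_power_reps T 2 -> has_power_reps T 3 -> has_power_reps T 4 ->
  exists k y q d, [/\ G3_change x y, q = q1 \/ q = q1^-1, biquadratic (nf_bq q d) y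
    & in_case T k d].
Proof.
move=> T2 T3 T4; have [m [d0 x0pres]] := quantum_normal_form q1_neq0 xq.
pose S q d := exists y : 'I_3 -> A,
  [/\ G3_change x y, q = q1 \/ q = q1^-1 & bq_presented (nf_bq q d) y].
have qV q : q = q1 \/ q = q1^-1 -> q^-1 = q1 \/ q^-1 = q1^-1.
  by case=> ->; [right|left; rewrite invrK].
have [||q d q0 [y [xy qE ypres]]|q d q0 [y [xy qE ypres]]|q [d [q0 [y [xy qE ypres]] le21 le32]]]
    := @rank_sort _ S q1 d0.
- exact: q1_neq0.
- exists (fun i => x i + (m i)%:A); split=> //; last by left.
  apply: G3_affine (G3_refl x) _; exists (fun=> 1), m; split=> i; first exact: oner_neq0.
  by rewrite scale1r.
- exists (y \o tperm 0 1); split; [|exact: qV|exact: nf_presented_swap01].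
  by apply: G3_perm xy _; exists (tperm 0 1).
- exists (y \o tperm 1 2); split; [|exact: qV|exact: nf_presented_swap12].
  by apply: G3_perm xy _; exists (tperm 1 2).
have [k [l [l0 dk]]] := sorted_in_case T2 T3 T4 le21 le32.
have ypres' := nf_presented_scale q0 l0 ypres.
exists k, (fun i => l i *: y i), q, (nf_scale l d); split=> //.
  apply: G3_affine xy _; exists l, (fun=> 0); split=> // i.
  by rewrite scale0r addr0.
split=> //; first by rewrite /= invr_neq0.
exact: presented_nf_pbw ypres'.
Qed.

(** The reference [d0] is the normal form obtained by shifting [x] to [z]. Any [y] is an affine
    change of a permutation of [z], which has a normal form with the same rank counts; rigidity
    leaves only a rescaling, which preserves the counts. *)
Lemma nf_invariants :
  exists d0 : nf_params K, forall y q (d : nf_params K), G3_change x y -> bq_relations (nf_bq q d) y ->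
  (q = q1 \/ q = q1^-1) /\ forall r, rank_count r d = rank_count r d0.
Proof.
have [m [d0 zpres]] := quantum_normal_form q1_neq0 xq; set z := (fun i => _) in zpres.
have q1_neq1 : q1 != 1 by case: xq.
exists d0 => y q d /G3_change_gen_change[l [m' [s [l0 yE]]]] yrel.
have {zpres} [q' [d' [q'E d'E zspres]]] : exists q' d', [/\ q' = q1 \/ q' = q1^-1,
    forall r, rank_count r d' = rank_count r d0 & bq_presented (nf_bq q' d') (z \o s)].
  have q0 q' : q' = q1 \/ q' = q1^-1 -> q' != 0 by case=> ->; rewrite ?invr_neq0.
  have qV q' : q' = q1 \/ q' = q1^-1 -> q'^-1 = q1 \/ q'^-1 = q1^-1.
    by case=> ->; [right|left; rewrite invrK].
  elim/S3_ind: s {yE} => [|s [q' [d' [q'E d'E pres]]]|s [q' [d' [q'E d'E pres]]]].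
  - exists q1, d0; split=> //; first by left.
    by apply: presented_ext zpres => i; rewrite /= perm1.
  - exists q'^-1, (nf_swap01 q' d'); split; [exact: qV| |].
      by move=> r; rewrite rank_count_swap01 ?q0.
    by apply: presented_ext (nf_presented_swap01 (q0 _ q'E) pres) => i; rewrite /= permM.
  - exists q'^-1, (nf_swap12 q' d'); split; [exact: qV| |].
      by move=> r; rewrite rank_count_swap12 ?q0.
    by apply: presented_ext (nf_presented_swap12 (q0 _ q'E) pres) => i; rewrite /= permM.
have q'0 : q' != 0 by case: q'E => ->; rewrite ?invr_neq0.
have q'1 : q' != 1 by case: q'E => ->; rewrite // -[1]invr1 (inj_eq invr_inj).
(* The shift is corrected because [y] is expressed through [z] instead of [x]. *)
have [|-> ->] := nf_rigid (l := l) (m := fun i => m' i - l i * m (s i)) q'1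
  (presented_nf_pbw q'0 zspres) zspres.1 yrel l0.
  by move=> i; rewrite yE /gen_change /z /=; linear_combination K; ring.
by split=> // r; rewrite rank_count_scale.
Qed.

End QuantumAlgebra.

(** * Uniqueness modulo powers and the classification *)

Lemma power_class_reps_has (K : fieldType) (T : nat -> K -> Prop) n :
  power_class_reps n (T n) -> has_power_reps T n.
Proof.
by move=> [_ TE] mu mu0; have [t [[Tt [xi [xi0 tE]]] _]] := TE mu mu0; exists t, xi.
Qed.

Lemma power_class_reps_eq (K : fieldType) (T : nat -> K -> Prop) n (mu t xi : K) :
  power_class_reps n (T n) -> T n mu -> T n t -> xi != 0 -> t = mu * xi ^+ n -> mu = t.
Proof.
move=> [T0 TE] Tmu Tt xi0 tE; have [u [_ uE]] := TE mu (T0 _ Tmu).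
transitivity u; first by apply/esym/uE; split=> //; exists 1; rewrite oner_neq0 expr1n mulr1.
by apply: uE; split=> //; exists xi.
Qed.

(** Entries equal to 1 before and after the rescaling constrain [l], so that every other nonzero
    entry is multiplied by a power of the required exponent; both values then represent the same
    class. *)
Lemma case_triple_scale (K : fieldType) (T : nat -> K -> Prop) k (l : 'I_3 -> K) (d : nf_params K) :
  (forall n, (2 <= n)%N -> power_class_reps n (T n)) -> (forall i, l i != 0) ->
  in_case T k d -> in_case T k (nf_scale l d) -> case_triple k d = case_triple k (nf_scale l d).
Proof.
move=> Treps l0; have := l0 0; have := l0 1; have := l0 2; rewrite /nf_scale.
have eqT n (mu t xi : K) : (2 <= n)%N -> T n mu -> T n t -> xi != 0 -> t = mu * xi ^+ n -> mu = t.
  by move=> /Treps; apply: power_class_reps_eq.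
move: (l 0) (l 1) (l 2) => l_0 l_1 l_2 l20 l10 l00.
case: d => c be la b1 b2 b3; case: k => /=.
- move=> [mu [nu [Tmu Tnu [-> -> ->]]]] [mu' [nu' [Tmu' Tnu' []]]].
  rewrite mulr1 => c1 muE nuE.
  have l2E : l_2 = l_0 * l_1 by rewrite -[LHS]mul1r -c1 mulfVK.
  rewrite c1 muE nuE; congr (_, _, _).
    by apply: (eqT 2%N _ _ l_0) => //; rewrite -muE l2E; field.
  by apply: (eqT 2%N _ _ l_1) => //; rewrite -nuE l2E; field.
- have l2E : l_0 * l_1 / l_2 = 1 -> l_2 = l_0 * l_1 by move=> c1; rewrite -[LHS]mul1r -c1 mulfVK.
  move=> [-> [[mu [Tmu [-> -> ->]]]|[mu [Tmu [-> -> ->]]]]] [_];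
    case=> -[mu' [Tmu' []]]; rewrite ?mulr1 => c1 muE e3; move/l2E: (c1) => {}l2E.
  (* From [l_2 = l_0 * l_1] and [l_1 * l_2 = 1]; hence [mu] is multiplied by [l_0^2], a fourth
     power. *)
  + have l0E : l_0 = l_1^-1 ^+ 2.
      by transitivity (l_1 * (l_0 * l_1) * l_1^-1 ^+ 2); [field|rewrite -l2E e3 mul1r].
    rewrite c1 muE e3; congr (_, _, _); apply: (eqT 4%N _ _ l_1^-1); rewrite ?invr_neq0 //.
    by rewrite -muE l2E l0E; field.
  + by move/eqP: e3; rewrite mulf_eq0 (negPf l10) (negPf l20).
  + by move/eqP: e3; rewrite mulr0 eq_sym oner_eq0.
  + rewrite c1 muE mulr0; congr (_, _, _).
    by apply: (eqT 2%N _ _ l_0) => //; rewrite -muE l2E; field.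
- have T0 mu : T 3%N mu -> mu != 0 by case: (Treps 3%N isT) => T0 _ /T0.
  (* Rescaling preserves vanishing, which excludes the mixed alternatives. *)
  have z2 : (l_0 * l_2 * b2 == 0) = (b2 == 0) by rewrite !mulf_eq0 (negPf l00) (negPf l20).
  have z3 : (l_1 * l_2 * b3 == 0) = (b3 == 0) by rewrite !mulf_eq0 (negPf l10) (negPf l20).
  move=> [_ _ h] [_ _ h']; move: z2 z3.
  case: h h' => [[mu [Tmu [-> -> ->]]]|[[-> -> ->]|[-> -> ->]]];
    case=> [[mu' [Tmu' [c1 e2 e3]]]|[[c1 e2 e3]|[c1 e2 e3]]];
    rewrite ?c1 ?e2 ?e3 ?eqxx ?oner_eq0 ?(negPf (T0 _ Tmu)) ?(negPf (T0 _ Tmu')) // => _ _.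
  rewrite !mulr1 in c1 e2.
  have l2E : l_2 = l_0 * l_1 by rewrite -[LHS]mul1r -c1 mulfVK.
  (* From [l_2 = l_0 * l_1] and [l_0 * l_2 = 1]; hence [b3] is multiplied by
     [l_1 * l_2 = l_0^-3]. *)
  have l1E : l_1 = l_0^-1 ^+ 2.
    by transitivity (l_0 * (l_0 * l_1) * l_0^-1 ^+ 2); [field|rewrite -l2E e2 mul1r].
  congr (_, _, _); apply: (eqT 3%N _ _ l_0^-1); rewrite ?invr_neq0 //.
  by rewrite -e3 l2E l1E; field.
- have T0 mu : T 2%N mu -> mu != 0 by case: (Treps 2%N isT) => T0 _ /T0.
  have z1 : (l_0 * l_1 * b1 == 0) = (b1 == 0) by rewrite !mulf_eq0 (negPf l00) (negPf l10).
  have z2 : (l_0 * l_2 * b2 == 0) = (b2 == 0) by rewrite !mulf_eq0 (negPf l00) (negPf l20).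
  have z3 : (l_1 * l_2 * b3 == 0) = (b3 == 0) by rewrite !mulf_eq0 (negPf l10) (negPf l20).
  move=> [_ _ _ h] [_ _ _ h']; move: z1 z2 z3.
  case: h h' => [[mu [Tmu [-> -> ->]]]|[[-> -> ->]|[[-> -> ->]|[-> -> ->]]]];
    case=> [[mu' [Tmu' [e1 e2 e3]]]|[[e1 e2 e3]|[[e1 e2 e3]|[e1 e2 e3]]]];
    rewrite ?e1 ?e2 ?e3 ?eqxx ?oner_eq0 ?(negPf (T0 _ Tmu)) ?(negPf (T0 _ Tmu')) // => _ _ _.
  rewrite !mulr1 in e1 e2.
  have l1E : l_1 = l_0^-1 by rewrite -[LHS](mulKf l00) e1 mulr1.
  have l2E : l_2 = l_0^-1 by rewrite -[LHS](mulKf l00) e2 mulr1.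
  congr (_, _, _); apply: (eqT 2%N _ _ l_0^-1); rewrite ?invr_neq0 //.
  by rewrite -e3 l2E l1E; field.
Qed.

Theorem theorem1p7 (K : fieldType) :
  (forall (A : algType K) (x : 'I_3 -> A) (q1 : K),
    quantum_biquadratic q1 x ->
    forall T : nat -> K -> Prop,
    (forall n : nat, (2 <= n)%N -> power_class_reps n (T n)) ->
    (* normal form, belonging to precisely one of the four cases *)
    (exists! k : nf_case,
      exists (y : 'I_3 -> A) (q : K) (d : nf_params K),
        [/\ G3_change x y, q = q1 \/ q = q1^-1, biquadratic (nf_bq q d) y
          & in_case T k d]) /\
    (* the classes modulo powers are determined up to rescaling *)
    (forall (k : nf_case) (y y' : 'I_3 -> A) (q q' : K) (d d' : nf_params K),
      G3_change x y -> affine_change y y' ->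
      biquadratic (nf_bq q d) y -> in_case T k d ->
      biquadratic (nf_bq q' d') y' -> in_case T k d' ->
      case_triple k d = case_triple k d')) /\
  ((forall u : K, exists v : K, v ^+ 2 = u) ->
   (forall u : K, exists v : K, v ^+ 3 = u) ->
    (forall (A : algType K) (x : 'I_3 -> A) (q1 : K),
      quantum_biquadratic q1 x ->
      exists! t : nf_type,
        exists (y : 'I_3 -> A) (q : K) (d : nf_params K),
          [/\ G3_change x y, q = q1 \/ q = q1^-1, biquadratic (nf_bq q d) y
            & in_type t d]) /\
    (* all the algebras in the list occur *)
    (forall (t : nf_type) (q : K) (d : nf_params K),
      q != 0 -> q != 1 -> in_type t d ->
      exists (A : algType K) (x : 'I_3 -> A),
        quantum_biquadratic q x /\ biquadratic (nf_bq q d) x)).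
Proof.
split=> [A x q1 xq T Treps|Ksqrt Kcbrt].
  have [d0 inv] := nf_invariants xq.
  have T0 n t : (2 <= n)%N -> T n t -> t != 0 by move=> /Treps[T0 _] /T0.
  have [k [y [q [d [xy qE ybq dk]]]]] : exists k y q d, [/\ G3_change x y, q = q1 \/ q = q1^-1,
      biquadratic (nf_bq q d) y & in_case T k d].
    by apply: (nf_exists xq); apply: power_class_reps_has; apply: Treps.
  split.
    exists k; split=> [|k' [y' [q' [d' [xy' _ [_ y'pres _] dk']]]]]; first by exists y, q, d.
    have [_ ypres _] := ybq.
    have [_ inv_y] := inv _ _ _ xy ypres.1; have [_ inv_y'] := inv _ _ _ xy' y'pres.1.
    have : case_rank k = case_rank k'.
      by rewrite -(in_case_rank T0 dk) -(in_case_rank T0 dk') inv_y inv_y'.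
    by case: k {dk}; case: k' {dk'}.
  move=> {y q d xy qE ybq k dk} k y y' q q' d d' xy [l [m [l0 y'E]]] [[/= q0 _ _] ypres _] dk.
  move=> [_ [y'rel _] _] d'k.
  have [qE _] := inv _ _ _ xy ypres.1.
  have q_neq1 : q != 1.
    by case: xq => q1_neq1 _; case: qE => ->; rewrite // -[1]invr1 (inj_eq invr_inj).
  have [_ d'E] := nf_rigid q_neq1 (presented_nf_pbw q0 ypres) ypres.1 y'rel l0 y'E.
  by rewrite d'E in d'k *; apply: case_triple_scale Treps l0 dk d'k.
(* If every element is an [n]-th power, 1 represents the only class, and the four cases turn into
   the ten types. *)
have root_reps n : (forall u : K, exists v, v ^+ n = u) -> (0 < n)%N ->
    has_power_reps (fun _ t => t = 1 :> K) n.
  move=> roots n0 mu mu0; have [v vE] := roots mu^-1; exists 1, v; split=> //.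
    by apply: contraNneq mu0 => v0; rewrite -invr_eq0 -vE v0 expr0n gtn_eqF.
  by rewrite vE divff.
have Kroot4 (u : K) : exists v, v ^+ 4 = u.
  by have [v <-] := Ksqrt u; have [w <-] := Ksqrt v; exists w; rewrite -exprM.
split=> [A x q1 xq|t q d q0 q_neq1 _].
  have [d0 inv] := nf_invariants xq.
  have [k [y [q [d [xy qE ybq dk]]]]] := nf_exists xq (root_reps _ Ksqrt isT)
    (root_reps _ Kcbrt isT) (root_reps _ Kroot4 isT).
  have [t dt] := in_case_type dk; exists t.
  split=> [|t' [y' [q' [d' [xy' _ [_ y'pres _] dt']]]]]; first by exists y, q, d.
  have [_ ypres _] := ybq.
  have [_ inv_y] := inv _ _ _ xy ypres.1; have [_ inv_y'] := inv _ _ _ xy' y'pres.1.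
  have : type_rank t = type_rank t'.
    by rewrite -(in_type_rank dt) -(in_type_rank dt') !inv_y !inv_y'.
  by case: t {dt}; case: t' {dt'}.
have xbq : biquadratic (nf_bq q d) (nf_gen d q0).
  by split; [rewrite /= invr_neq0|apply: nf_gen_presented|apply: nf_gen_pbw].
exists (nf_algebra d q0), (nf_gen d q0); split=> //; split=> //.
by exists (nf_bq q d); split=> //=; rewrite invrK.
Qed.
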